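(* Let $\lambda\in\mathbb R$, $r>0$, and let $\varphi:M^m\to\mathbb S^n(r)$ be a $CMC$ proper $\lambda$-biharmonic immersion. Then $\lambda<m/r^2$ and $|H|\in\left(0,\sqrt{\frac1{r^2}-\frac\lambda m}\,\right]$. Moreover, $|H|=\sqrt{\frac1{r^2}-\frac\lambda m}$ if and only if $M$ is minimal in a small hypersphere $\mathbb S^{n-1}\left(\sqrt{\frac{mr^2}{2m-\lambda r^2}}\right)\subset\mathbb S^n(r)$.
   Context: Manifolds are smooth and connected; immersions are isometric. $\mathbb S^n(r)$ is the Euclidean sphere of radius $r$ centered at the origin of $\mathbb R^{n+1}$; a small hypersphere of radius $a<r$ of $\mathbb S^n(r)$ is its intersection with an affine hyperplane not passing through the origin. For an isometric immersion $\varphi:M^m\to N$, $B$ is the second fundamental form and $H=\frac1m\operatorname{trace}B$; $\varphi$ is minimal if $H=0$ and $CMC$ if $|H|$ is constant. The tension field is $\tau(\varphi)=mH$, and the bitension field is $\tau_2(\varphi)=-\Delta^\varphi\tau(\varphi)-\operatorname{trace}R^N(d\varphi(\cdot),\tau(\varphi))d\varphi(\cdot)$, where $\Delta^\varphi=-\operatorname{trace}(\nabla^\varphi\nabla^\varphi-\nabla^\varphi_{\nabla})$ and $R^N(X,Y)Z=\nabla_X\nabla_YZ-\nabla_Y\nabla_XZ-\nabla_{[X,Y]}Z$. For a real constant $\lambda$, $\varphi$ is $\lambda$-biharmonic if $\tau_2(\varphi)=\lambda\tau(\varphi)$; it is proper $\lambda$-biharmonic if moreover it is not minimal. *)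

(* Defs.v *)
From mathcomp Require Import all_boot all_order all_algebra.
From mathcomp Require Import all_classical all_reals all_analysis.
Import Order.TTheory GRing.Theory Num.Theory.
Import numFieldNormedType.Exports.

Set Implicit Arguments.
Unset Strict Implicit.
Unset Printing Implicit Defensive.

Local Open Scope classical_set_scope.
Local Open Scope ring_scope.

(* The library norm on matrices is the sup norm, hence [enorm]. *)
Definition dot (R : realType) (N : nat) (u v : 'rV[R]_N) : R :=
  (u *m v^T) 0 0.

Definition enorm (R : realType) (N : nat) (u : 'rV[R]_N) : R :=
  Num.sqrt (dot u u).

Fixpoint iter_partial (R : realType) (m : nat) (W : normedModType R)
    (s : seq 'I_m) (f : 'rV[R]_m -> W) : 'rV[R]_m -> W :=
  if s is i :: s' then fun x => 'D_(delta_mx 0 i) (iter_partial s' f) x else f.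

(* On an open set, this is C^oo: differentiability of every iterated partial
   derivative makes all of them continuous. *)
Definition smooth_on (R : realType) (m : nat) (W : normedModType R)
    (U : set 'rV[R]_m) (f : 'rV[R]_m -> W) : Prop :=
  forall (s : seq 'I_m) x, U x -> differentiable (iter_partial s f) x.

(* A homeomorphism from an open subset of M onto an open subset of R^m;
   [cmap] and [cinv] carry no information outside [cdom] and its image. *)
Record chart (R : realType) (m : nat) (M : topologicalType) := Chart {
  cdom : set M;
  cmap : M -> 'rV[R]_m;
  cinv : 'rV[R]_m -> M;
  cdom_open : open cdom;
  cimg_open : open (cmap @` cdom);
  cmapK : forall p, cdom p -> cinv (cmap p) = p;
  cmap_continuous : {within cdom, continuous cmap};
  cinv_continuous : {within cmap @` cdom, continuous cinv}
}.

(* [chart_at p] is a preferred chart around p; it serves to evaluate at p the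
   chart-independent expressions below. *)
Record manifold (R : realType) (m : nat) := Manifold {
  carrier :> topologicalType;
  carrier_hausdorff : hausdorff_space carrier;
  carrier_second_countable : @second_countable carrier;
  carrier_connected : connected [set: carrier];
  atlas : set (chart R m carrier);
  chart_at : carrier -> chart R m carrier;
  chart_at_atlas : forall p, atlas (chart_at p);
  chart_at_dom : forall p, cdom (chart_at p) p;
  transition_smooth : forall c c', atlas c -> atlas c' ->
    smooth_on (cmap c @` (cdom c `&` cdom c')) (cmap c' \o cinv c)
}.

(* [metric c p] is the Gram matrix at p of the coordinate frame of c. *)
Record riemannian_metric (R : realType) (m : nat) (M : manifold R m) :=
  RiemannianMetric {
  metric : chart R m M -> M -> 'M[R]_m;
  metric_sym : forall c p, atlas c -> cdom c p ->
    (metric c p)^T = metric c p;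
  metric_posdef : forall c p, atlas c -> cdom c p ->
    forall v : 'rV[R]_m, v != 0 -> 0 < (v *m metric c p *m v^T) 0 0;
  metric_smooth : forall c, atlas c ->
    smooth_on (cmap c @` cdom c) (metric c \o cinv c);
  metric_change : forall c c' p, atlas c -> atlas c' ->
    cdom c p -> cdom c' p ->
    let J := jacobian (cmap c \o cinv c') (cmap c' p) in
    metric c' p = J *m metric c p *m J^T
}.

Definition dchart (R : realType) (m : nat) (M : manifold R m)
    (W : normedModType R) (c : chart R m M) (i : 'I_m) (F : M -> W) (p : M) : W :=
  'D_(delta_mx 0 i) (F \o cinv c) (cmap c p).

Definition smooth (R : realType) (m : nat) (M : manifold R m)
    (W : normedModType R) (F : M -> W) : Prop :=
  forall c, atlas c -> smooth_on (cmap c @` cdom c) (F \o cinv c).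

Definition christoffel (R : realType) (m : nat) (M : manifold R m)
    (g : riemannian_metric M) (c : chart R m M) (k i j : 'I_m) (p : M) : R :=
  2^-1 * \sum_l invmx (metric g c p) k l *
    (dchart c i (fun q => metric g c q j l : R^o) p
     + dchart c j (fun q => metric g c q i l : R^o) p
     - dchart c l (fun q => metric g c q i j : R^o) p).

Definition gtrace (R : realType) (m : nat) (M : manifold R m)
    (g : riemannian_metric M) (V : lmodType R) (c : chart R m M) (p : M)
    (T : 'I_m -> 'I_m -> V) : V :=
  \sum_i \sum_j invmx (metric g c p) i j *: T i j.

(* A submanifold S of R^N, with the induced metric, is described by a field
   [nu] that lists at each point of S an orthonormal basis of the normal space.
   Its Levi-Civita connection is the tangential part of the directional
   derivative of R^N. *)
Definition tproj (R : realType) (N : nat) (nu : 'rV[R]_N -> seq 'rV[R]_N)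
    (x w : 'rV[R]_N) : 'rV[R]_N :=
  w - \sum_(u <- nu x) dot w u *: u.

Definition nabla (R : realType) (N : nat) (nu : 'rV[R]_N -> seq 'rV[R]_N)
    (X Y : 'rV[R]_N -> 'rV[R]_N) (x : 'rV[R]_N) : 'rV[R]_N :=
  tproj nu x ('D_(X x) Y x).

Definition lie_bracket (R : realType) (N : nat)
    (X Y : 'rV[R]_N -> 'rV[R]_N) (x : 'rV[R]_N) : 'rV[R]_N :=
  'D_(X x) Y x - 'D_(Y x) X x.

(* The curvature tensor at x, computed on the tangent extensions
   [tproj nu ^~ u] of tangent vectors u at x; being a tensor, its value does
   not depend on the extensions. *)
Definition curvature (R : realType) (N : nat) (nu : 'rV[R]_N -> seq 'rV[R]_N)
    (x u v w : 'rV[R]_N) : 'rV[R]_N :=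
  let X := tproj nu ^~ u in
  let Y := tproj nu ^~ v in
  let Z := tproj nu ^~ w in
  nabla nu X (nabla nu Y Z) x - nabla nu Y (nabla nu X Z) x
  - nabla nu (lie_bracket X Y) Z x.

Section SubmanifoldGeometry.
Context (R : realType) (m N : nat) (M : manifold R m).
Context (g : riemannian_metric M) (nu : 'rV[R]_N -> seq 'rV[R]_N).
Context (phi : M -> 'rV[R]_N).

(* Sections of the pull-back of TS are functions M -> R^N; this is the
   derivative of V along the i-th coordinate field of c. *)
Definition pullback_nabla (c : chart R m M) (i : 'I_m) (V : M -> 'rV[R]_N)
    (p : M) : 'rV[R]_N :=
  tproj nu (phi p) (dchart c i V p).

Definition second_fundamental_form (c : chart R m M) (i j : 'I_m) (p : M) :
    'rV[R]_N :=
  pullback_nabla c i (dchart c j phi) p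
  - \sum_k christoffel g c k i j p *: dchart c k phi p.

Definition mean_curvature (p : M) : 'rV[R]_N :=
  let c := chart_at p in
  m%:R^-1 *: gtrace g c p (fun i j => second_fundamental_form c i j p).

Definition tension (p : M) : 'rV[R]_N := m%:R *: mean_curvature p.

Definition rough_laplacian (V : M -> 'rV[R]_N) (p : M) : 'rV[R]_N :=
  let c := chart_at p in
  - gtrace g c p (fun i j =>
      pullback_nabla c i (pullback_nabla c j V) p
      - \sum_k christoffel g c k i j p *: pullback_nabla c k V p).

Definition bitension (p : M) : 'rV[R]_N :=
  let c := chart_at p in
  - rough_laplacian tension p
  - gtrace g c p (fun i j =>
      curvature nu (phi p) (dchart c i phi p) (tension p) (dchart c j phi p)).

Definition isometric_immersion (S : set 'rV[R]_N) : Prop :=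
  [/\ forall p, S (phi p), smooth phi
    & forall c p, atlas c -> cdom c p ->
      forall i j, dot (dchart c i phi p) (dchart c j phi p) = metric g c p i j].

Definition minimal : Prop := forall p, mean_curvature p = 0.

Definition cmc : Prop := exists h : R, forall p, enorm (mean_curvature p) = h.

Definition lambda_biharmonic (lambda : R) : Prop :=
  forall p, bitension p = lambda *: tension p.

Definition proper_lambda_biharmonic (lambda : R) : Prop :=
  lambda_biharmonic lambda /\ ~ minimal.

End SubmanifoldGeometry.

Definition sphere (R : realType) (n : nat) (r : R) : set 'rV[R]_n.+1 :=
  [set x | enorm x = r].

Definition sphere_normal (R : realType) (n : nat) (r : R) (x : 'rV[R]_n.+1) :
    seq 'rV[R]_n.+1 := [:: r^-1 *: x].

(* For a unit vector [eta] and d != 0, this is a small hypersphere; it is the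
   round sphere of the hyperplane with center [d *: eta] and radius a, where
   d ^+ 2 + a ^+ 2 = r ^+ 2. *)
Definition small_hypersphere (R : realType) (n : nat) (r : R)
    (eta : 'rV[R]_n.+1) (d : R) : set 'rV[R]_n.+1 :=
  sphere r `&` [set x | dot x eta = d].

Definition small_hypersphere_normal (R : realType) (n : nat)
    (eta : 'rV[R]_n.+1) (d a : R) (x : 'rV[R]_n.+1) : seq 'rV[R]_n.+1 :=
  [:: eta; a^-1 *: (x - d *: eta)].

Definition minimal_in_small_hypersphere (R : realType) (m n : nat)
    (M : manifold R m) (g : riemannian_metric M) (phi : M -> 'rV[R]_n.+1)
    (r a : R) : Prop :=
  exists (eta : 'rV[R]_n.+1) (d : R),
    [/\ enorm eta = 1, d != 0, 0 < a, d ^+ 2 + a ^+ 2 = r ^+ 2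
      & isometric_immersion g phi (small_hypersphere r eta d) /\
        minimal g (small_hypersphere_normal eta d a) phi].

(* Main.v *)
Require Import Defs.
From mathcomp Require Import all_boot all_order all_algebra.
From mathcomp Require Import all_classical all_reals all_analysis.
From mathcomp Require Import ring.
Import Order.TTheory GRing.Theory Num.Theory.
Import numFieldNormedType.Exports.

(** Let V be the tension field m H. Tested against V, the equation
    tau_2 = lambda tau becomes an identity between scalars. The rough Laplacian
    contributes the trace S of the inner products of the covariant derivatives
    of V, because |V| is constant: differentiating |V|^2 twice turns
    second derivatives of V into products of first ones, and the Christoffel
    terms disappear. The curvature of the sphere contributes m |V|^2 / r^2.
    Hence S = (m / r^2 - lambda) |V|^2.

    On the other hand V is normal, so the trace of the inner products of its
    derivatives with those of phi is - |V|^2. Expanding the nonnegative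
    trace of the squares of d_i V + (|V|^2 / m) d_i phi gives S >= |V|^4 / m,
    which is m h^2 <= m / r^2 - lambda for h = |H|; this is
    [cmc_biharmonic_identity], and it yields both bounds.

    Equality forces d_i H = - h^2 d_i phi, so that H + h^2 phi is a constant
    vector xi on the connected manifold M ([cmc_biharmonic_rigid]). The
    products <phi, xi> and |xi| are then determined by h, so phi lies in the
    hyperplane section of the sphere orthogonal to xi, and the mean curvature
    of phi in R^(n+1) is a combination of xi and phi, both normal to that
    section: M is minimal there ([minimal_of_constant]). Conversely, minimality
    in a small hypersphere of radius a means that the mean curvature in
    R^(n+1) is - 1/a times the unit radial vector, whence
    h^2 = 1 / a^2 - 1 / r^2 ([minimal_in_small_hypersphere_norm]).

    The tension field at a point p is defined through a chart that depends on
    p, so it can be differentiated only after its chart-independence is known.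
    The vector Delta phi, the g-trace of the second derivatives of phi minus
    their Christoffel part, is normal to M, and a change of chart modifies the
    trace of the second derivatives by a tangent vector only; a vector that is
    both tangent and normal vanishes ([laplace_chart]). *)

Set Implicit Arguments.
Unset Strict Implicit.
Unset Printing Implicit Defensive.

Local Open Scope classical_set_scope.
Local Open Scope ring_scope.

(** * The Euclidean inner product *)

Section Dot.
Context (R : realType) (N : nat).
Implicit Types (u v w : 'rV[R]_N) (a : R).

Lemma dotE u v : dot u v = \sum_k u 0 k * v 0 k.
Proof. by rewrite /dot mxE; apply: eq_bigr => k _; rewrite mxE. Qed.

Lemma dotC u v : dot u v = dot v u.
Proof. by rewrite !dotE; apply: eq_bigr => k _; rewrite mulrC. Qed.

Lemma dotDl u v w : dot (u + v) w = dot u w + dot v w.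
Proof. by rewrite /dot mulmxDl mxE. Qed.

Lemma dotZl a u w : dot (a *: u) w = a * dot u w.
Proof. by rewrite /dot -scalemxAl mxE. Qed.

Lemma dot0l w : dot 0 w = 0.
Proof. by rewrite /dot mul0mx mxE. Qed.

Lemma dotNl u w : dot (- u) w = - dot u w.
Proof. by rewrite -scaleN1r dotZl mulN1r. Qed.

Lemma dotBl u v w : dot (u - v) w = dot u w - dot v w.
Proof. by rewrite dotDl dotNl. Qed.

Lemma dot_suml I (s : seq I) (P : pred I) (F : I -> 'rV[R]_N) w :
  dot (\sum_(i <- s | P i) F i) w = \sum_(i <- s | P i) dot (F i) w.
Proof. by elim/big_rec2: _ => [|i x y _ <-]; rewrite ?dot0l ?dotDl. Qed.

Lemma dotDr u v w : dot w (u + v) = dot w u + dot w v.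
Proof. by rewrite !(dotC w) dotDl. Qed.

Lemma dotZr a u w : dot w (a *: u) = a * dot w u.
Proof. by rewrite !(dotC w) dotZl. Qed.

Lemma dot0r w : dot w 0 = 0.
Proof. by rewrite dotC dot0l. Qed.

Lemma dotBr u v w : dot w (u - v) = dot w u - dot w v.
Proof. by rewrite !(dotC w) dotBl. Qed.

Lemma dot_ge0 u : 0 <= dot u u.
Proof. by rewrite dotE sumr_ge0// => k _; rewrite -expr2 sqr_ge0. Qed.

Lemma dot_eq0 u : (dot u u == 0) = (u == 0).
Proof.
apply/eqP/eqP => [|->]; last by rewrite dot0l.
rewrite dotE => /eqP; rewrite psumr_eq0; last by move=> k _; rewrite -expr2 sqr_ge0.
move=> /allP u0; apply/rowP => k; rewrite mxE; apply/eqP.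
by rewrite -sqrf_eq0 expr2; apply: u0; rewrite mem_index_enum.
Qed.

Lemma sqr_enorm u : enorm u ^+ 2 = dot u u.
Proof. by rewrite /enorm sqr_sqrtr// dot_ge0. Qed.

Lemma enorm_ge0 u : 0 <= enorm u.
Proof. exact: sqrtr_ge0. Qed.

Lemma enorm_eq0 u : (enorm u == 0) = (u == 0).
Proof. by rewrite -dot_eq0 -sqr_enorm sqrf_eq0. Qed.

End Dot.

(** * Differentiation rules *)

Section Calculus.
Context (R : realType).

(** Matrices have finitely many entries: a matrix-valued map is the sum of its
    entries times constant elementary matrices. *)
Lemma differentiable_mxP (V : normedModType R) (k n : nat)
    (F : V -> 'M[R]_(k, n)) x :
  differentiable F x <-> forall i j, differentiable (fun y => F y i j : R) x.
Proof.
split=> [dF i j|dF].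
  exact: (differentiable_comp dF (differentiable_coord _ i j)).
have -> : F = \sum_i \sum_j (fun y => F y i j *: delta_mx i j).
  apply/funext => y; rewrite fct_sumE [LHS]matrix_sum_delta.
  by apply: eq_bigr => i _; rewrite fct_sumE.
apply: differentiable_sum => i; apply: differentiable_sum => j.
exact: differentiableZl.
Qed.

Lemma derive_coord (V : normedModType R) (k n : nat)
    (F : V -> 'M[R]_(k, n)) x v i j : differentiable F x ->
  'D_v (fun y => F y i j : R) x = ('D_v F x) i j.
Proof. by move=> dF; rewrite derive_mx ?mxE//; exact: diff_derivable. Qed.

Lemma derive_dir_sum (m : nat) (W : normedModType R) (f : 'rV[R]_m -> W) x v :
  differentiable f x -> 'D_v f x = \sum_i v 0 i *: 'D_(delta_mx 0 i) f x.
Proof.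
move=> df; rewrite deriveE// {1}[v]row_sum_delta linear_sum.
by apply: eq_bigr => i _; rewrite linearZ deriveE.
Qed.

End Calculus.

Section Rules.
Context (R : realType) (V : normedModType R).

Lemma derive_bigsum (W : normedModType R) n (h : 'I_n -> V -> W) x v :
  (forall i, differentiable (h i) x) ->
  'D_v (fun y => \sum_i h i y) x = \sum_i 'D_v (h i) x.
Proof.
move=> dh; have -> : (fun y => \sum_i h i y) = \sum_i h i.
  by apply/funext => y; rewrite fct_sumE.
by rewrite derive_sum// => i; exact/diff_derivable.
Qed.

Lemma differentiableZM (k l : nat) (a : V -> R)
    (F : V -> 'M[R]_(k, l)) x :
  differentiable a x -> differentiable F x ->
  differentiable (fun y => a y *: F y) x.
Proof.
move=> da /differentiable_mxP dF; apply/differentiable_mxP => i j.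
under eq_fun do rewrite mxE; exact: (differentiableM da (dF i j)).
Qed.

Lemma deriveZM (k n : nat) (a : V -> R) (F : V -> 'M[R]_(k, n)) x v :
  differentiable a x -> differentiable F x ->
  'D_v (fun y => a y *: F y) x = 'D_v a x *: F x + a x *: 'D_v F x.
Proof.
move=> da dF; have dFij := (differentiable_mxP F x).1 dF.
have daF := differentiableZM da dF.
apply/matrixP => i j; rewrite -derive_coord// !mxE -derive_coord//.
under eq_fun do rewrite mxE.
rewrite (@deriveM _ _ a (fun y => F y i j)); try exact/diff_derivable.
by rewrite addrC [F x i j *: _]mulrC.
Qed.

Lemma derive_dot (n : nat) (F G : V -> 'rV[R]_n) x v :
  differentiable F x -> differentiable G x ->
  'D_v (fun y => dot (F y) (G y) : R) x
  = dot ('D_v F x) (G x) + dot (F x) ('D_v G x).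
Proof.
move=> dF dG; under eq_fun do rewrite dotE.
have dFk := (differentiable_mxP F x).1 dF 0.
have dGk := (differentiable_mxP G x).1 dG 0.
rewrite derive_bigsum; last by move=> k; exact: (differentiableM (dFk k) (dGk k)).
rewrite !dotE -big_split /=; apply: eq_bigr => k _.
rewrite (@deriveM _ _ (fun y => F y 0 k) (fun y => G y 0 k));
  try exact/diff_derivable.
by rewrite addrC -!derive_coord// [G x 0 k *: _]mulrC.
Qed.

Lemma differentiable_dot (n : nat) (F G : V -> 'rV[R]_n) x :
  differentiable F x -> differentiable G x ->
  differentiable (fun y => dot (F y) (G y) : R) x.
Proof.
move=> /differentiable_mxP dF /differentiable_mxP dG.
have -> : (fun y => dot (F y) (G y) : R) = \sum_k (fun y => F y 0 k * G y 0 k).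
  by apply/funext => y; rewrite fct_sumE dotE.
by apply: differentiable_sum => k; exact: (differentiableM (dF 0 k) (dG 0 k)).
Qed.

Lemma is_derive_line (W : normedModType R) (f : V -> W) x a (s : R) :
  differentiable f (x + s *: a) ->
  is_derive s 1 (fun t : R => f (x + t *: a)) ('D_a f (x + s *: a)).
Proof.
move=> df; pose l (t : R) := x + t *: a.
have dl : is_diff s l ( *:%R ^~ a).
  by apply: is_diff_eq; rewrite add0r.
have dfl : differentiable (f \o l) s by exact: differentiable_comp.
apply: DeriveDef; first exact/diff_derivable/dfl.
by rewrite (deriveE _ dfl) diff_comp//= diff_val scale1r deriveE.
Qed.

End Rules.

(** * Smooth functions on an open set *)

Section SmoothOn.
Context (R : realType) (m : nat) (U : set 'rV[R]_m).
Hypothesis U_open : open U.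
Local Notation d_ i := (delta_mx 0 i).

Lemma iter_partial_rcons (W : normedModType R) (s : seq 'I_m) i
    (f : 'rV[R]_m -> W) :
  iter_partial (rcons s i) f = iter_partial s (fun x => 'D_(d_ i) f x).
Proof. by elim: s => //= j s ->. Qed.

Lemma near_eq_on (W : Type) (f g : 'rV[R]_m -> W) x :
  {in U, f =1 g} -> U x -> {near x, f =1 g}.
Proof.
move=> fg Ux; near=> y; apply: fg; rewrite inE; near: y.
exact: open_nbhs_nbhs.
Unshelve. all: by end_near. Qed.

Lemma derive_on (W : normedModType R) (f g : 'rV[R]_m -> W) v x :
  {in U, f =1 g} -> U x -> 'D_v f x = 'D_v g x.
Proof. by move=> fg Ux; apply: near_eq_derive; exact: near_eq_on. Qed.

Lemma iter_partial_on (W : normedModType R) (f g : 'rV[R]_m -> W) s :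
  {in U, f =1 g} -> {in U, iter_partial s f =1 iter_partial s g}.
Proof.
by move=> fg; elim: s => //= i s IH x; rewrite inE; exact: derive_on.
Qed.

(** The difference is zero near [x], so it is its own first order expansion with
    zero differential. *)
Lemma near_eq_differentiable (V W : normedModType R) (f g : V -> W) x :
  {near x, f =1 g} -> differentiable f x -> differentiable g x.
Proof.
move=> fg df.
suff dh : differentiable (g - f) x.
  have -> : g = (g - f) + f by rewrite subrK.
  exact: differentiableD.
have hE : (g - f) \o shift x = cst ((g - f) x) + (\0 : V -> W) +o_ 0 id.
  apply/eqaddoP => _ /posnumP[e]; near=> y.
  have -> : ((g - f) \o shift x - (cst ((g - f) x) + (\0 : V -> W))) y = 0.
    have fgx : f x = g x := nbhs_singleton fg.
    have : f (y + x) = g (y + x).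
      by near: y; move: fg; rewrite (near_shift 0) subr0.
    by rewrite /= !fctE /= => ->; rewrite fgx !subrr addr0 subr0.
  by rewrite normr0 mulr_ge0.
apply/diff_locallyP; rewrite (diff_unique _ hE); last exact: cst_continuous.
by split => //; exact: cst_continuous.
Unshelve. all: by end_near. Qed.

End SmoothOn.

Section SmoothClosure.
Context (R : realType) (m : nat) (U : set 'rV[R]_m).
Hypothesis U_open : open U.
Local Notation d_ i := (delta_mx 0 i).

Lemma smooth_on_diff (W : normedModType R) (f : 'rV[R]_m -> W) x :
  smooth_on U f -> U x -> differentiable f x.
Proof. by move=> sf; exact: (sf [::]). Qed.

Lemma smooth_on_derive (W : normedModType R) (f : 'rV[R]_m -> W) i :
  smooth_on U f -> smooth_on U ('D_(d_ i) f).
Proof. by move=> sf s; have := sf (rcons s i); rewrite iter_partial_rcons. Qed.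

(** Smoothness is the largest property that implies differentiability and is
    inherited, on the open set, by all partial derivatives. *)
Lemma smooth_on_coind (W : normedModType R) (P : ('rV[R]_m -> W) -> Prop) :
  (forall f, P f -> (forall x, U x -> differentiable f x) /\
     forall i, exists2 g, P g & {in U, 'D_(d_ i) f =1 g}) ->
  forall f, P f -> smooth_on U f.
Proof.
move=> Pdiff f Pf s x Ux; elim/last_ind: s f Pf => [|s i IH] f Pf.
  exact: (Pdiff f Pf).1.
have [g Pg fg] := (Pdiff f Pf).2 i; rewrite iter_partial_rcons.
apply: (near_eq_differentiable _ (IH g Pg)); apply: (near_eq_on U_open) => // y Uy.
by rewrite (iter_partial_on U_open _ fg).
Qed.

Lemma smooth_on_eq (W : normedModType R) (f g : 'rV[R]_m -> W) :
  {in U, f =1 g} -> smooth_on U f -> smooth_on U g.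
Proof.
move=> fg sf s x Ux; apply: (near_eq_differentiable _ (sf s x Ux)).
by apply: (near_eq_on U_open) => //; exact: (iter_partial_on U_open).
Qed.

(** The derivative of an expression built from smooth functions by sums,
    products and inverses is again such an expression. This syntactic class is
    what makes the induction go through: the derivative of a product or of an
    inverse alone is neither. *)
Inductive smooth_expr : ('rV[R]_m -> R) -> Prop :=
| smooth_expr_base f : smooth_on U f -> smooth_expr f
| smooth_exprD f g : smooth_expr f -> smooth_expr g -> smooth_expr (f + g)
| smooth_exprM f g : smooth_expr f -> smooth_expr g -> smooth_expr (f * g)
| smooth_exprV f : smooth_expr f -> (forall x, U x -> f x != 0) ->
    smooth_expr (fun x => (f x)^-1).

Lemma smooth_on_cst (W : normedModType R) (a : W) : smooth_on U (cst a).
Proof.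
apply: (smooth_on_coind (P := fun f => exists a, f = cst a)); last by exists a.
move=> _ [b ->]; split=> [x _|i]; first exact: differentiable_cst.
by exists (cst 0); [exists 0|move=> x _; exact: derive_cst].
Qed.

Lemma smooth_expr_smooth f : smooth_expr f -> smooth_on U f.
Proof.
apply: smooth_on_coind => {}f; elim=> {f} [f sf|f g _ [df Df] _ [dg Dg]
  |f g ef [df Df] eg [dg Dg]|f ef [df Df] f0]; split=> [x Ux|i].
- exact: smooth_on_diff sf Ux.
- by exists ('D_(d_ i) f) => //; apply/smooth_expr_base/smooth_on_derive.
- by apply: differentiableD; [exact: df|exact: dg].
- have [f' ef' ff'] := Df i; have [g' eg' gg'] := Dg i.
  exists (f' + g'); first exact: smooth_exprD.
  move=> x; rewrite inE => Ux.
  rewrite deriveD; [|exact/diff_derivable/df|exact/diff_derivable/dg].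
  by rewrite ff' ?gg' ?inE.
- by apply: differentiableM; [exact: df|exact: dg].
- have [f' ef' ff'] := Df i; have [g' eg' gg'] := Dg i.
  exists (f * g' + g * f'); first by apply: smooth_exprD; exact: smooth_exprM.
  move=> x; rewrite inE => Ux.
  rewrite deriveM; [|exact/diff_derivable/df|exact/diff_derivable/dg].
  by rewrite ff' ?gg' ?inE.
- by apply: differentiableV; [exact: df|exact: f0].
- have [f' ef' ff'] := Df i.
  exists (cst (-1) * f' * (fun x => (f x)^-1) * (fun x => (f x)^-1)).
    apply: smooth_exprM; last exact: smooth_exprV.
    apply: smooth_exprM; last exact: smooth_exprV.
    by apply: smooth_exprM => //; exact/smooth_expr_base/smooth_on_cst.
  move=> x; rewrite inE => Ux.
  rewrite deriveV; [|exact: f0|exact/diff_derivable/df].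
  rewrite ff' ?inE// !fctE /GRing.scale /= ?exprVn ?expr2 ?invfM.
  by rewrite !mulNr mul1r mulrC mulrA.
Qed.

Lemma smooth_onM (f g : 'rV[R]_m -> R) :
  smooth_on U f -> smooth_on U g -> smooth_on U (fun x => f x * g x).
Proof.
move=> sf sg; apply: smooth_expr_smooth.
by apply: (@smooth_exprM f g); exact: smooth_expr_base.
Qed.

Lemma smooth_onV (f : 'rV[R]_m -> R) : smooth_on U f ->
  (forall x, U x -> f x != 0) -> smooth_on U (fun x => (f x)^-1).
Proof.
by move=> sf f0; apply: smooth_expr_smooth; apply: smooth_exprV => //;
  exact: smooth_expr_base.
Qed.

Lemma smooth_on_mxP (k n : nat) (F : 'rV[R]_m -> 'M[R]_(k, n)) :
  smooth_on U F <-> forall i j, smooth_on U (fun x => F x i j : R).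
Proof.
split=> [sF i j|].
  apply: (smooth_on_coind (P := fun f => exists2 F : 'rV[R]_m -> 'M[R]_(k, n),
    smooth_on U F & f = fun x => F x i j)); last by exists F.
  move=> _ [{}F {}sF ->]; split=> [x Ux|l].
    by apply: (differentiable_mxP F x).1; exact: smooth_on_diff.
  exists (fun x => 'D_(d_ l) F x i j).
    by exists ('D_(d_ l) F) => //; exact: smooth_on_derive.
  move=> x; rewrite inE => Ux; apply: derive_coord; exact: smooth_on_diff Ux.
apply: (smooth_on_coind (P := fun F : 'rV[R]_m -> 'M[R]_(k, n) =>
  forall i j, smooth_on U (fun x => F x i j : R))) => {}F sF.
have dF x : U x -> differentiable F x.
  by move=> Ux; apply/differentiable_mxP => i j; exact: smooth_on_diff (sF i j) Ux.
split=> // l; exists ('D_(d_ l) F) => // i j.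
apply: (smooth_on_eq _ (smooth_on_derive l (sF i j))) => x.
by rewrite inE => Ux; exact/derive_coord/dF.
Qed.

Lemma smooth_onD (W : normedModType R) (f g : 'rV[R]_m -> W) :
  smooth_on U f -> smooth_on U g -> smooth_on U (fun x => f x + g x).
Proof.
move=> sf sg; apply: (smooth_on_coind (P := fun h => exists f g : 'rV[R]_m -> W,
  [/\ smooth_on U f, smooth_on U g & h = f + g])); last by exists f, g.
move=> _ [{}f [{}g [{}sf {}sg ->]]]; split=> [x Ux|i].
  by apply: differentiableD; exact: smooth_on_diff Ux.
exists ('D_(d_ i) f + 'D_(d_ i) g).
  by exists ('D_(d_ i) f), ('D_(d_ i) g); split => //; exact: smooth_on_derive.
by move=> x; rewrite inE => Ux; apply: deriveD;
  apply/diff_derivable; exact: smooth_on_diff Ux.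
Qed.

Lemma smooth_on_sum (W : normedModType R) I (s : seq I) (P : pred I)
    (f : I -> 'rV[R]_m -> W) : (forall i, smooth_on U (f i)) ->
  smooth_on U (fun x => \sum_(i <- s | P i) f i x).
Proof.
move=> sf; elim: s => [|i s IH].
  by under eq_fun do rewrite big_nil; exact: smooth_on_cst.
under eq_fun do rewrite big_cons.
by case: (P i) => //; exact: smooth_onD.
Qed.

Lemma smooth_on_prod I (s : seq I) (P : pred I) (f : I -> 'rV[R]_m -> R) :
  (forall i, smooth_on U (f i)) ->
  smooth_on U (fun x => \prod_(i <- s | P i) f i x).
Proof.
move=> sf; elim: s => [|i s IH].
  by under eq_fun do rewrite big_nil; exact: smooth_on_cst.
under eq_fun do rewrite big_cons.
by case: (P i) => //; exact: smooth_onM.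
Qed.

Lemma smooth_onZ (k n : nat) (a : 'rV[R]_m -> R) (F : 'rV[R]_m -> 'M[R]_(k, n)) :
  smooth_on U a -> smooth_on U F -> smooth_on U (fun x => a x *: F x).
Proof.
move=> sa /smooth_on_mxP sF; apply/smooth_on_mxP => i j.
by under eq_fun do rewrite mxE; exact: smooth_onM.
Qed.

Lemma smooth_on_det (n : nat) (A : 'rV[R]_m -> 'M[R]_n) :
  smooth_on U A -> smooth_on U (fun x => \det (A x)).
Proof.
move=> /smooth_on_mxP sA; rewrite /determinant; apply: smooth_on_sum => s.
by apply: smooth_onM; [exact: smooth_on_cst|exact: smooth_on_prod].
Qed.

(** By Cramer's formula the entries of the inverse are rational functions of
    the entries. *)
Lemma smooth_on_invmx (n : nat) (A : 'rV[R]_m -> 'M[R]_n) :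
  (forall x, U x -> A x \in unitmx) -> smooth_on U A ->
  smooth_on U (fun x => invmx (A x)).
Proof.
move=> uA sA.
apply: (smooth_on_eq (f := fun x => (\det (A x))^-1 *: \adj (A x))).
  by move=> x; rewrite inE => /uA Ax; rewrite /invmx Ax.
apply: smooth_onZ.
  apply: smooth_onV; first exact: smooth_on_det.
  by move=> x /uA; rewrite unitmxE unitfE.
apply/smooth_on_mxP => i j; under eq_fun do rewrite mxE /cofactor.
apply: smooth_onM; first exact: smooth_on_cst.
apply: smooth_on_det; apply/smooth_on_mxP => k l.
by under eq_fun do rewrite !mxE; exact: (smooth_on_mxP A).1.
Qed.

End SmoothClosure.

(** * Mixed partials, the chain rule and constancy *)

Section Schwarz.
Context (R : realType) (V : normedModType R).

(** The mean value theorem in the direction [a] turns the second difference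
    into [t] times an increment of ['D_a f] in the direction [b]. Its first
    order expansion at [x] needs only the differentiability of ['D_a f] at [x]. *)
Lemma second_increment (f : V -> R) (a b x : V) :
  (\forall y \near x, differentiable f y) -> differentiable ('D_a f) x ->
  forall e : R, 0 < e -> \forall t \near 0^'+,
    `|f (x + t *: a + t *: b) - f (x + t *: a) - f (x + t *: b) + f x
      - t ^+ 2 * 'D_b ('D_a f) x| <= t ^+ 2 * e.
Proof.
move=> df dDf e e0.
(* a point x + s a + u b with s, u in [0, t] is at distance at most t N of x *)
pose N := `|a| + `|b| + 1; have N0 : 0 < N by rewrite /N ltr_wpDl// addr_ge0.
pose eta := e / (2 * N); have eta0 : 0 < eta by rewrite divr_gt0// mulr_gt0.
have [d d0 dP] : exists2 d : R, 0 < d & forall y, `|y| < d ->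
    differentiable f (x + y) /\
    `|'D_a f (x + y) - 'D_a f x - 'd ('D_a f) x y| <= eta * `|y|.
  have : \forall y \near 0, differentiable f (x + y) /\
    `|'D_a f (x + y) - 'D_a f x - 'd ('D_a f) x y| <= eta * `|y|.
    near=> y; split.
      rewrite addrC; near: y. by move: df; rewrite (near_shift 0) subr0.
    near: y; have /diff_locally := dDf => /eqaddoP /(_ eta eta0).
    apply: filterS => y; rewrite /= !fctE.
    by rewrite opprD addrA (addrC y).
  move=> /nbhs_norm0P[d /= d0 dP]; exists d => // y yd; exact: dP.
near=> t.
have t0 : 0 < t by near: t; exact: nbhs_right_gt.
have td : t * N < d.
  rewrite -ltr_pdivlMr//; near: t; apply: nbhs_right_lt; exact: divr_gt0.
have small s u : 0 <= s <= t -> 0 <= u <= t -> `|s *: a + u *: b| <= t * N.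
  move=> /andP[s0 st] /andP[u0 ut]; rewrite (le_trans (ler_normD _ _))//.
  rewrite !normrZ !ger0_norm// /N !mulrDr mulr1.
  by rewrite ler_wpDr ?(ltW t0)// lerD// ler_wpM2r.
have dfsu s u : 0 <= s <= t -> 0 <= u <= t ->
    differentiable f (x + u *: b + s *: a).
  move=> sP uP; rewrite -addrA (addrC (u *: b)).
  by apply: (dP _ _).1; exact: le_lt_trans (small _ _ sP uP) td.
have tt : 0 <= t <= t by rewrite (ltW t0) lexx.
have zt : (0 : R) <= 0 <= t by apply/andP; split; [exact: lexx|exact: ltW].
(* the second difference is g t - g 0 *)
pose g (s : R) := f (x + t *: b + s *: a) - f (x + 0 *: b + s *: a).
pose dg (s : R) := 'D_a f (x + t *: b + s *: a) - 'D_a f (x + 0 *: b + s *: a).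
have gd s : 0 <= s <= t -> is_derive s 1 g (dg s).
  by move=> sP; apply: is_deriveB; apply: is_derive_line; exact: dfsu.
have [c cP] : exists2 c, c \in `]0, t[%R & g t - g 0 = dg c * (t - 0).
  apply: MVT => //.
    by move=> s; rewrite in_itv /= => /andP[/ltW s0 /ltW st]; apply: gd; rewrite s0.
  apply: derivable_within_continuous => s; rewrite in_itv /= => sP.
  by have [] := gd s sP.
rewrite subr0 => gE.
have -> : f (x + t *: a + t *: b) - f (x + t *: a) - f (x + t *: b) + f x = g t - g 0.
  rewrite /g !scale0r !addr0 (addrAC x (t *: b)).
  by ring.
have {}cP : 0 <= c <= t.
  by move: cP; rewrite in_itv /= => /andP[/ltW-> /ltW->].
rewrite gE deriveE//.
have -> : dg c * t - t ^+ 2 * 'd ('D_a f) x b = t * (dg c - 'd ('D_a f) x (t *: b)).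
  have -> : 'd ('D_a f) x (t *: b) = t * 'd ('D_a f) x b by rewrite linearZ.
  by ring.
rewrite normrM gtr0_norm// expr2 -mulrA ler_wpM2l ?(ltW t0)//.
have -> : dg c - 'd ('D_a f) x (t *: b) =
    ('D_a f (x + (c *: a + t *: b)) - 'D_a f x - 'd ('D_a f) x (c *: a + t *: b))
    - ('D_a f (x + (c *: a + 0 *: b)) - 'D_a f x - 'd ('D_a f) x (c *: a + 0 *: b)).
  rewrite /dg scale0r !addr0 (addrAC x (t *: b)) (addrA x) linearD /=.
  by ring.
have lc := small _ _ cP tt; have lc0 := small _ _ cP zt.
rewrite (le_trans (ler_normB _ _))//.
have h1 := (dP _ (le_lt_trans lc td)).2.
have h2 := (dP _ (le_lt_trans lc0 td)).2.
rewrite (le_trans (lerD h1 h2))// -mulrDr.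
have -> : t * e = eta * (t * N + t * N).
  by rewrite /eta; field; rewrite gt_eqF.
by rewrite ler_wpM2l ?(ltW eta0)// lerD.
Unshelve. all: by end_near. Qed.

(** The second difference is symmetric in [a] and [b], so both mixed derivatives
    are its limit after division by [t ^+ 2]. *)
Lemma derive_swap (f : V -> R) (a b x : V) :
  (\forall y \near x, differentiable f y) ->
  differentiable ('D_a f) x -> differentiable ('D_b f) x ->
  'D_a ('D_b f) x = 'D_b ('D_a f) x.
Proof.
move=> df da db; apply/eqP; rewrite -subr_eq0 -normr_le0.
apply/ler_addgt0Pr => e e0; rewrite add0r.
have e20 : 0 < e / 2 by rewrite divr_gt0.
have H1 := second_increment b df da e20.
have H2 := second_increment a df db e20.
have [t [h1 [h2 t0]]] := filter_ex (filterI H1 (filterI H2 (nbhs_right_gt 0))).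
have t20 : 0 < t ^+ 2 by rewrite exprn_gt0.
rewrite -(ler_pM2l t20) -[X in X * _ <= _]gtr0_norm// -normrM.
have := le_trans (ler_normB _ _) (lerD h1 h2).
rewrite (addrAC x (t *: b)) -mulrDr -splitr; congr (`|_| <= _).
move: ('D_a _ x) ('D_b _ x) (f (x + t *: a + t *: b)) (f (x + t *: a)).
by move: (f (x + t *: b)) (f x) => p q A B u v; ring.
Qed.

End Schwarz.

Section Chain.
Context (R : realType) (m l : nat).
Local Notation d_ i := (delta_mx 0 i).

Lemma derive_chain (W : normedModType R) (f : 'rV[R]_l -> W)
    (T : 'rV[R]_m -> 'rV[R]_l) y v :
  differentiable T y -> differentiable f (T y) ->
  'D_v (f \o T) y = \sum_a 'D_v T y 0 a *: 'D_(d_ a) f (T y).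
Proof.
move=> dT df; rewrite deriveE; last exact: differentiable_comp.
by rewrite diff_comp//= -deriveE// -deriveE// derive_dir_sum.
Qed.

(** The second derivatives of [T] enter only through first derivatives of [f]:
    for an immersion [f] this part is tangent. *)
Lemma derive2_chain (n : nat) (U : set 'rV[R]_l) (U' : set 'rV[R]_m)
    (f : 'rV[R]_l -> 'rV[R]_n) (T : 'rV[R]_m -> 'rV[R]_l) i j y :
  open U -> open U' -> smooth_on U f -> smooth_on U' T ->
  (forall z, U' z -> U (T z)) -> U' y ->
  'D_(d_ i) ('D_(d_ j) (f \o T)) y =
  \sum_a 'D_(d_ i) ('D_(d_ j) T) y 0 a *: 'D_(d_ a) f (T y)
  + \sum_a \sum_b ('D_(d_ j) T y 0 a * 'D_(d_ i) T y 0 b) *: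
      'D_(d_ b) ('D_(d_ a) f) (T y).
Proof.
move=> oU oU' sf sT TU Uy.
have dT z : U' z -> differentiable T z by exact: smooth_on_diff sT.
have dDT z : U' z -> differentiable ('D_(d_ j) T) z.
  by apply: smooth_on_diff; exact: smooth_on_derive.
have dDf a z : U z -> differentiable ('D_(d_ a) f) z.
  by apply: smooth_on_diff; exact: smooth_on_derive.
rewrite (derive_on oU'
  (g := fun z => \sum_a 'D_(d_ j) T z 0 a *: 'D_(d_ a) f (T z)))//; last first.
  move=> z; rewrite inE => Uz; apply: derive_chain; first exact: dT.
  exact: smooth_on_diff sf (TU _ Uz).
have dc a : differentiable (fun z => 'D_(d_ j) T z 0 a : R) y.
  exact: (differentiable_mxP _ _).1 (dDT y Uy) 0 a.
have dcf a : differentiable (fun z => 'D_(d_ a) f (T z)) y.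
  exact: (differentiable_comp (dT _ Uy) (dDf a _ (TU _ Uy))).
rewrite derive_bigsum; last first.
  move=> a; apply/differentiable_mxP => i' k; under eq_fun do rewrite mxE.
  exact: (differentiableM (dc a) ((differentiable_mxP _ _).1 (dcf a) i' k)).
rewrite -big_split /=; apply: eq_bigr => a _.
rewrite deriveZM// derive_coord; last exact: dDT.
congr (_ + _); rewrite (derive_chain (f := 'D_(d_ a) f)); last 2 first.
- exact: dT.
- exact/dDf/TU.
by rewrite scaler_sumr; apply: eq_bigr => b _; rewrite scalerA.
Qed.

End Chain.

(** Mean value theorem along the segment from the centre. *)
Lemma zero_partials_cst (R : realType) (m : nat) (f : 'rV[R]_m -> R) x (e : R) :
  (forall y, ball x e y -> differentiable f y) ->
  (forall y i, ball x e y -> 'D_(delta_mx 0 i) f y = 0) ->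
  forall y, ball x e y -> f y = f x.
Proof.
move=> df f0 y xy; pose g (s : R) := f (x + s *: (y - x)).
have xs (s : R) : 0 <= s <= 1 -> ball x e (x + s *: (y - x)).
  move=> /andP[s0 s1]; move: xy; rewrite -!ball_normE /= => xy.
  rewrite opprD addrA subrr add0r normrN normrZ ger0_norm// distrC.
  by apply: le_lt_trans xy; rewrite ler_piMl.
have dg (s : R) : 0 <= s <= 1 -> is_derive s 1 g 0.
  move=> sP; have := is_derive_line (df _ (xs s sP)).
  rewrite derive_dir_sum; last exact/df/xs.
  by rewrite big1// => i _; rewrite f0 ?scaler0//; exact: xs.
have [||c _] := @MVT_segment R g (cst 0) 0 1 ler01.
- by move=> s; rewrite in_itv /= => /andP[/ltW s0 /ltW s1]; apply: dg; rewrite s0.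
- apply: derivable_within_continuous => s; rewrite in_itv /= => sP.
  by have [] := dg s sP.
rewrite mul0r /g scale1r scale0r addr0 subrKC.
by move/eqP; rewrite subr_eq0 => /eqP.
Qed.

(** * Calculus in a chart *)

Section ChartCalculus.
Context (R : realType) (m : nat) (M : manifold R m) (c : chart R m M).

Definition chart_smooth (W : normedModType R) (F : M -> W) : Prop :=
  smooth_on (cmap c @` cdom c) (F \o cinv c).

Lemma cmap_cimg p : cdom c p -> (cmap c @` cdom c) (cmap c p).
Proof. by move=> cp; exists p. Qed.

Lemma cinv_dom x : (cmap c @` cdom c) x -> cdom c (cinv c x).
Proof. by case=> p cp <-; rewrite cmapK. Qed.

Lemma cinvK x : (cmap c @` cdom c) x -> cmap c (cinv c x) = x.
Proof. by case=> p cp <-; rewrite cmapK. Qed.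

Lemma dchart_eq (W : normedModType R) (F G : M -> W) i p :
  {in cdom c, F =1 G} -> cdom c p -> dchart c i F p = dchart c i G p.
Proof.
move=> FG cp; rewrite /dchart; apply: (derive_on (@cimg_open _ _ _ c));
  last exact: cmap_cimg.
by move=> x; rewrite inE => /cinv_dom cx; rewrite /= FG// inE.
Qed.

Lemma chart_smooth_eq (W : normedModType R) (F G : M -> W) :
  {in cdom c, F =1 G} -> chart_smooth F -> chart_smooth G.
Proof.
move=> FG; apply: (smooth_on_eq (@cimg_open _ _ _ c)) => x.
by rewrite inE => /cinv_dom cx; rewrite /= FG// inE.
Qed.

Lemma dchart_cinv (W : normedModType R) (F : M -> W) i :
  {in cmap c @` cdom c,
    dchart c i F \o cinv c =1 'D_(delta_mx 0 i) (F \o cinv c)}.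
Proof. by move=> x; rewrite inE => cx; rewrite /= /dchart cinvK. Qed.

Lemma chart_smooth_dchart (W : normedModType R) (F : M -> W) i :
  chart_smooth F -> chart_smooth (dchart c i F).
Proof.
move=> /(smooth_on_derive i); apply: (smooth_on_eq (@cimg_open _ _ _ c)) => x Ux.
by rewrite dchart_cinv.
Qed.

Lemma dchart2E (W : normedModType R) (F : M -> W) i j p : cdom c p ->
  dchart c i (dchart c j F) p =
  'D_(delta_mx 0 i) ('D_(delta_mx 0 j) (F \o cinv c)) (cmap c p).
Proof.
move=> cp; rewrite {1}/dchart; apply: (derive_on (@cimg_open _ _ _ c));
  last exact: cmap_cimg.
exact: dchart_cinv.
Qed.

Lemma chart_smooth_diff (W : normedModType R) (F : M -> W) p :
  chart_smooth F -> cdom c p -> differentiable (F \o cinv c) (cmap c p).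
Proof. by move=> sF cp; apply: smooth_on_diff sF _; exact: cmap_cimg. Qed.

Lemma chart_smooth_coord (k n : nat) (F : M -> 'M[R]_(k, n)) i j :
  chart_smooth F -> chart_smooth (fun p => F p i j : R).
Proof.
by move=> sF; exact: ((smooth_on_mxP (@cimg_open _ _ _ c) (F \o cinv c)).1 sF i j).
Qed.

Lemma chart_smoothZ (k n : nat) (a : M -> R) (F : M -> 'M[R]_(k, n)) :
  chart_smooth a -> chart_smooth F -> chart_smooth (fun p => a p *: F p).
Proof. by move=> sa sF; exact: (smooth_onZ (@cimg_open _ _ _ c) sa sF). Qed.

Lemma chart_smoothM (a b : M -> R) :
  chart_smooth a -> chart_smooth b -> chart_smooth (fun p => a p * b p).
Proof. by move=> sa sb; exact: (smooth_onM (@cimg_open _ _ _ c) sa sb). Qed.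

Lemma chart_smooth_cst (W : normedModType R) (a : W) : chart_smooth (fun=> a).
Proof. exact: (@smooth_on_cst _ _ (cmap c @` cdom c) (@cimg_open _ _ _ c) _ a). Qed.

Lemma chart_smoothD (W : normedModType R) (F G : M -> W) :
  chart_smooth F -> chart_smooth G -> chart_smooth (fun p => F p + G p).
Proof. by move=> sF sG; exact: (smooth_onD (@cimg_open _ _ _ c) sF sG). Qed.

Lemma chart_smoothN (k n : nat) (F : M -> 'M[R]_(k, n)) :
  chart_smooth F -> chart_smooth (fun p => - F p).
Proof.
move=> sF; under eq_fun do rewrite -scaleN1r.
by apply: chart_smoothZ => //; exact: chart_smooth_cst.
Qed.

Lemma chart_smooth_sum (W : normedModType R) I (s : seq I) (P : pred I)
    (F : I -> M -> W) : (forall i, chart_smooth (F i)) ->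
  chart_smooth (fun p => \sum_(i <- s | P i) F i p).
Proof. by move=> sF; exact: (smooth_on_sum (@cimg_open _ _ _ c) s P sF). Qed.

Lemma chart_smooth_invmx (n : nat) (A : M -> 'M[R]_n) :
  (forall p, cdom c p -> A p \in unitmx) -> chart_smooth A ->
  chart_smooth (fun p => invmx (A p)).
Proof.
move=> uA sA; apply: (smooth_on_invmx (@cimg_open _ _ _ c) _ sA) => x /cinv_dom cx.
exact: uA.
Qed.

Lemma dchart_dot (n : nat) (F G : M -> 'rV[R]_n) i p :
  chart_smooth F -> chart_smooth G -> cdom c p ->
  dchart c i (fun q => dot (F q) (G q) : R) p
  = dot (dchart c i F p) (G p) + dot (F p) (dchart c i G p).
Proof.
move=> sF sG cp; rewrite /dchart.
have := derive_dot (delta_mx 0 i) (chart_smooth_diff sF cp) (chart_smooth_diff sG cp).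
by rewrite /= !cmapK.
Qed.

Lemma dchartD (W : normedModType R) (F G : M -> W) i p :
  chart_smooth F -> chart_smooth G -> cdom c p ->
  dchart c i (fun q => F q + G q) p = dchart c i F p + dchart c i G p.
Proof.
move=> sF sG cp; rewrite /dchart.
by apply: (@deriveD _ _ _ (F \o cinv c) (G \o cinv c));
  apply/diff_derivable; exact: chart_smooth_diff.
Qed.

Lemma dchartZ (W : normedModType R) (a : R) (F : M -> W) i p :
  chart_smooth F -> cdom c p ->
  dchart c i (fun q => a *: F q) p = a *: dchart c i F p.
Proof.
move=> sF cp; rewrite /dchart.
apply: (@deriveZ _ _ _ (F \o cinv c)).
by apply/diff_derivable; exact: chart_smooth_diff.
Qed.

Lemma dchart_coord (k n : nat) (F : M -> 'M[R]_(k, n)) i p a b :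
  chart_smooth F -> cdom c p ->
  dchart c i (fun q => F q a b : R) p = dchart c i F p a b.
Proof.
move=> sF cp; rewrite /dchart.
exact: (derive_coord _ _ _ (chart_smooth_diff sF cp)).
Qed.

Lemma dchart_cst (W : normedModType R) (a : W) i p : dchart c i (fun=> a) p = 0.
Proof. exact: derive_cst. Qed.

Lemma dchart_swap_scalar (f : M -> R) i j p :
  chart_smooth f -> cdom c p ->
  dchart c i (dchart c j f) p = dchart c j (dchart c i f) p.
Proof.
move=> sf cp; rewrite (dchart2E _ i j cp) (dchart2E _ j i cp).
have df l := smooth_on_diff (smooth_on_derive l sf) (cmap_cimg cp).
apply: (derive_swap _ (df i) (df j)).
near=> x; apply: (smooth_on_diff sf).
near: x; apply: open_nbhs_nbhs; split; [exact: cimg_open|exact: cmap_cimg].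
Unshelve. all: by end_near. Qed.

(** Partial derivatives in one chart commute, component by component. *)
Lemma dchart_swap (n : nat) (F : M -> 'rV[R]_n) i j p :
  chart_smooth F -> cdom c p ->
  dchart c i (dchart c j F) p = dchart c j (dchart c i F) p.
Proof.
move=> sF cp; apply/rowP => k.
have sFi l : chart_smooth (dchart c l F) by exact: chart_smooth_dchart.
have coordE l l' : dchart c l (dchart c l' F) p 0 k =
    dchart c l (dchart c l' (fun q => F q 0 k : R)) p.
  rewrite -dchart_coord//; apply: dchart_eq => // q; rewrite inE => cq.
  by rewrite dchart_coord.
have swapk := dchart_swap_scalar i j (chart_smooth_coord 0 k sF) cp.
exact: etrans (coordE i j) (etrans swapk (esym (coordE j i))).
Qed.

End ChartCalculus.

(** * Traces against an inverse Gram matrix *)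

Section PositiveDefinite.
Context (R : realType) (m : nat) (G : 'M[R]_m).
Hypothesis G_sym : G^T = G.
Hypothesis G_pos : forall v : 'rV[R]_m, v != 0 -> 0 < (v *m G *m v^T) 0 0.

Lemma posdef_unitmx : G \in unitmx.
Proof.
rewrite -row_free_unit -kermx_eq0; apply/eqP/row_matrixP => i; rewrite row0.
apply/eqP; apply: contraT => /G_pos.
by rewrite -row_mul mulmx_ker row0 mul0mx mxE ltxx.
Qed.

Lemma invmx_posdef (v : 'rV[R]_m) : v != 0 -> 0 < (v *m invmx G *m v^T) 0 0.
Proof.
move=> v0; have uG := posdef_unitmx.
have : v *m invmx G != 0.
  by apply: contra_neq v0 => /(congr1 (mulmx^~ G)); rewrite mulmxKV// mul0mx.
by move=> /G_pos; rewrite trmx_mul trmx_inv G_sym mulmxKV// mulmxA.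
Qed.

(** The trace splits over an orthonormal basis of the ambient space into
    values of the quadratic form of [P], one per coordinate. *)
Lemma gram_traceE (N : nat) (P : 'M[R]_m) (Z : 'I_m -> 'rV[R]_N) :
  \sum_i \sum_j P i j * dot (Z i) (Z j) =
  \sum_k ((\row_i Z i 0 k) *m P *m (\row_i Z i 0 k)^T) 0 0.
Proof.
transitivity (\sum_i \sum_j \sum_k P i j * (Z i 0 k * Z j 0 k)).
  apply: eq_bigr => i _; apply: eq_bigr => j _.
  by rewrite dotE mulr_sumr.
transitivity (\sum_k \sum_j \sum_i Z i 0 k * P i j * Z j 0 k); last first.
  apply: eq_bigr => k _; rewrite mxE; apply: eq_bigr => j _.
  by rewrite !mxE mulr_suml; apply: eq_bigr => i _; rewrite mxE.
rewrite [LHS]exchange_big [RHS]exchange_big /=; apply: eq_bigr => j _.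
rewrite exchange_big; apply: eq_bigr => k _; apply: eq_bigr => i _ /=.
by rewrite mulrA [P i j * _]mulrC.
Qed.

Lemma gram_trace_ge0 (N : nat) (Z : 'I_m -> 'rV[R]_N) :
  0 <= \sum_i \sum_j invmx G i j * dot (Z i) (Z j).
Proof.
rewrite gram_traceE sumr_ge0// => k _; set v := \row_i _.
by have [->|/invmx_posdef/ltW//] := eqVneq v 0; rewrite !mul0mx mxE.
Qed.

Lemma gram_trace_eq0 (N : nat) (Z : 'I_m -> 'rV[R]_N) :
  \sum_i \sum_j invmx G i j * dot (Z i) (Z j) = 0 -> forall i, Z i = 0.
Proof.
rewrite gram_traceE => /eqP; rewrite psumr_eq0; last first.
  move=> k _; set v := \row_i _.
  by have [->|/invmx_posdef/ltW//] := eqVneq v 0; rewrite !mul0mx mxE.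
move=> /allP Z0 i; apply/rowP => k; rewrite mxE.
have : \row_i Z i 0 k = 0.
  apply/eqP; apply: contraT => /invmx_posdef.
  by have /eqP -> := Z0 k (mem_index_enum k); rewrite ltxx.
by move=> /rowP/(_ i); rewrite !mxE.
Qed.

Lemma gram_trace_metric : \sum_i \sum_j invmx G i j * G i j = m%:R.
Proof.
transitivity (\tr (invmx G *m G)); last by rewrite mulVmx ?posdef_unitmx// mxtrace1.
apply: eq_bigr => i _; rewrite mxE; apply: eq_bigr => j _.
by congr (_ * _); rewrite -[in RHS]G_sym mxE.
Qed.

(** Expansion of a trace of squares. Its left-hand side is nonnegative, so this
    is the Cauchy-Schwarz inequality between [W] and [E] with its defect; the
    coefficient [s / m] is the one that completes the square. *)
Lemma gram_trace_expand (N : nat) (E W : 'I_m -> 'rV[R]_N) (s : R) :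
  (0 < m)%N -> (forall i j, dot (E i) (E j) = G i j) ->
  \sum_i \sum_j invmx G i j * dot (W i) (E j) = - s ->
  \sum_i \sum_j invmx G i j *
    dot (W i + (s / m%:R) *: E i) (W j + (s / m%:R) *: E j) =
  \sum_i \sum_j invmx G i j * dot (W i) (W j) - s ^+ 2 / m%:R.
Proof.
move=> m0 EG WE; set t := s / m%:R.
have P_sym i j : invmx G i j = invmx G j i.
  by rewrite -[in RHS]G_sym -trmx_inv mxE.
have EW : \sum_i \sum_j invmx G i j * dot (E i) (W j) = - s.
  rewrite -WE exchange_big /=; apply: eq_bigr => i _; apply: eq_bigr => j _.
  by rewrite P_sym dotC.
have -> : \sum_i \sum_j invmx G i j * dot (W i + t *: E i) (W j + t *: E j) =
    \sum_i \sum_j invmx G i j * dot (W i) (W j)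
    + t * (\sum_i \sum_j invmx G i j * dot (W i) (E j))
    + t * (\sum_i \sum_j invmx G i j * dot (E i) (W j))
    + t ^+ 2 * (\sum_i \sum_j invmx G i j * G i j).
  rewrite !mulr_sumr -!big_split /=; apply: eq_bigr => i _.
  rewrite !mulr_sumr -!big_split /=; apply: eq_bigr => j _.
  by rewrite dotDl !dotDr !dotZl !dotZr EG; ring.
rewrite WE EW gram_trace_metric /t; field.
by rewrite pnatr_eq0 -lt0n.
Qed.

End PositiveDefinite.

(** Koszul's formula in a frame: here [A i j] stands for the second derivatives
    of an immersion and [E] for the first ones, so the sum in the parentheses
    is the combination of derivatives of the metric in the Christoffel symbols.
    The symmetry of [A] makes all but two equal terms cancel. *)
Lemma koszul (R : realType) (m N : nat) (G : 'M[R]_m) (A : 'I_m -> 'I_m -> 'rV[R]_N)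
    (E : 'I_m -> 'rV[R]_N) i j l :
  G \in unitmx -> G^T = G -> (forall a b, A a b = A b a) ->
  \sum_k (2^-1 * \sum_h invmx G k h *
    ((dot (A i j) (E h) + dot (E j) (A i h))
     + (dot (A j i) (E h) + dot (E i) (A j h))
     - (dot (A h i) (E j) + dot (E i) (A h j)))) * G k l = dot (A i j) (E l).
Proof.
move=> uG G_sym A_sym; pose a := \row_h dot (A i j) (E h).
have -> : dot (A i j) (E l) = (a *m (G *m invmx G)^T) 0 l.
  by rewrite mulmxV// trmx1 mulmx1 mxE.
rewrite trmx_mul G_sym mulmxA mxE; apply: eq_bigr => k _; congr (_ * _).
rewrite mxE mulr_sumr; apply: eq_bigr => h _.
rewrite (A_sym j i) (A_sym h i) (A_sym h j) (dotC (A i h)) !mxE; by field.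
Qed.

(** The trace of a bilinear form does not depend on the frame. *)
Lemma gtrace_change (R : comRingType) (m : nat) (V : lmodType R) (P P' J : 'M[R]_m)
    (B : 'I_m -> 'I_m -> V) : J^T *m P' *m J = P ->
  \sum_i \sum_j P' i j *: (\sum_a \sum_b (J j a * J i b) *: B b a)
  = \sum_b \sum_a P b a *: B b a.
Proof.
move=> <-.
transitivity (\sum_b \sum_a \sum_i \sum_j (P' i j * (J j a * J i b)) *: B b a).
  under eq_bigr => i _ do under eq_bigr => j _ do
    (rewrite scaler_sumr; under eq_bigr => a _ do rewrite scaler_sumr).
  rewrite [RHS]exchange_big /=.
  under eq_bigr => i _ do
    (rewrite exchange_big /=; under eq_bigr => a _ do rewrite exchange_big /=).
  rewrite exchange_big /=; apply: eq_bigr => a _.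
  rewrite exchange_big /=.
  apply: eq_bigr => b _; apply: eq_bigr => i _; apply: eq_bigr => j _.
  by rewrite scalerA.
apply: eq_bigr => b _; apply: eq_bigr => a _; rewrite mxE scaler_suml exchange_big.
apply: eq_bigr => j _ /=; rewrite mxE mulr_suml scaler_suml; apply: eq_bigr => i _.
by rewrite mxE; congr (_ *: _); ring.
Qed.

(** Two families of second derivatives related by a change of frame up to
    tangent vectors (the rows of [F]) have the same trace up to a tangent
    vector. *)
Lemma gtrace_change_sub (R : realType) (m n k : nat) (P P' J : 'M[R]_m)
    (B A : 'I_m -> 'I_m -> 'rV[R]_n) (F : 'M[R]_(k, n)) :
  J^T *m P' *m J = P ->
  (forall i j, (A i j - \sum_a \sum_b (J j a * J i b) *: B b a <= F)%MS) ->
  (\sum_i \sum_j P' i j *: A i j - \sum_b \sum_a P b a *: B b a <= F)%MS.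
Proof.
move=> PE AB; rewrite -(gtrace_change B PE) -sumrB summx_sub// => i _.
by rewrite -sumrB summx_sub// => j _; rewrite -scalerBr scalemx_sub.
Qed.

(** A class modulo the row space of [F] has at most one member orthogonal to the
    rows of [F]. *)
Lemma normal_representative_unique (R : realType) (k n : nat) (F : 'M[R]_(k, n))
    (x x' y y' : 'rV[R]_n) :
  (x' - x <= F)%MS -> (x' - y' <= F)%MS -> (x - y <= F)%MS ->
  y' *m F^T = 0 -> y *m F^T = 0 -> y' = y.
Proof.
move=> xx' xy' xy y'F yF.
have /submxP[t dE] : (y' - y <= F)%MS.
  have -> : y' - y = (x' - x) - (x' - y') + (x - y).
    by apply/rowP => i; rewrite !mxE; ring.
  by rewrite addmx_sub// addmx_sub// -scaleN1r scalemx_sub.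
have dF : (y' - y) *m F^T = 0 by rewrite mulmxBl y'F yF subrr.
apply/eqP; rewrite -subr_eq0 -dot_eq0 /dot {2}dE trmx_mul mulmxA dF mul0mx.
by rewrite mxE.
Qed.

(** * The Laplacian of an immersion *)

Section ImmersedManifold.
Context (R : realType) (m N : nat) (M : manifold R m).
Context (g : riemannian_metric M) (phi : M -> 'rV[R]_N).
Hypothesis phi_smooth : smooth phi.
Hypothesis phi_metric : forall c p, atlas c -> cdom c p ->
  forall i j, dot (dchart c i phi p) (dchart c j phi p) = metric g c p i j.

(** The Laplace-Beltrami operator applied to the components of [phi]; it is
    also the tension field of [phi] as a map to the Euclidean space. *)
Definition laplace (c : chart R m M) (p : M) : 'rV[R]_N :=
  gtrace g c p (fun i j => dchart c i (dchart c j phi) p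
    - \sum_k christoffel g c k i j p *: dchart c k phi p).

Definition frame (c : chart R m M) (p : M) : 'M[R]_(m, N) :=
  \matrix_(i < m) dchart c i phi p.

Section InChart.
Context (c : chart R m M).
Hypothesis cA : atlas c.

Lemma metric_unitmx p : cdom c p -> metric g c p \in unitmx.
Proof. by move=> cp; apply: posdef_unitmx; exact: metric_posdef. Qed.

Lemma chart_smooth_phi : chart_smooth c phi.
Proof. exact: phi_smooth. Qed.

Lemma chart_smooth_dphi i : chart_smooth c (dchart c i phi).
Proof. exact/chart_smooth_dchart/chart_smooth_phi. Qed.

Lemma chart_smooth_metric : chart_smooth c (metric g c).
Proof. exact: metric_smooth. Qed.

Lemma dchart_metric i j l p : cdom c p ->
  dchart c i (fun q => metric g c q j l : R) p =
  dot (dchart c i (dchart c j phi) p) (dchart c l phi p)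
  + dot (dchart c j phi p) (dchart c i (dchart c l phi) p).
Proof.
move=> cp; rewrite -dchart_dot//; try exact: chart_smooth_dphi.
by apply: dchart_eq => // q; rewrite inE => cq; rewrite phi_metric.
Qed.

(** The Levi-Civita connection of the induced metric is the tangential part of
    the flat one. *)
Lemma christoffelE i j l p : cdom c p ->
  \sum_k christoffel g c k i j p * metric g c p k l =
  dot (dchart c i (dchart c j phi) p) (dchart c l phi p).
Proof.
move=> cp.
have A_sym a b := dchart_swap a b chart_smooth_phi cp.
have G_sym := Defs.metric_sym g cA cp.
have /= <- := koszul (fun a => dchart c a phi p) i j l (metric_unitmx cp) G_sym
  A_sym.
apply: eq_bigr => k _; congr (_ * _); rewrite /christoffel; congr (_ * _).
apply: eq_bigr => h _; congr (_ * _).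
by congr (_ + _ - _); apply: dchart_metric.
Qed.

(** Beltrami's formula: subtracting the Christoffel terms removes exactly the
    tangential part of the second derivatives. *)
Lemma laplace_normal p l : cdom c p ->
  dot (laplace c p) (dchart c l phi p) = 0.
Proof.
move=> cp; rewrite dot_suml big1// => i _; rewrite dot_suml big1// => j _.
rewrite dotZl dotBl dot_suml -(christoffelE i j l cp) -sumrB big1 ?mulr0// => k _.
by rewrite dotZl phi_metric// subrr.
Qed.

Lemma chart_smooth_laplace : chart_smooth c (laplace c).
Proof.
have sP : chart_smooth c (fun p => invmx (metric g c p)).
  apply: chart_smooth_invmx chart_smooth_metric => p; exact: metric_unitmx.
have sdG i j l : chart_smooth c (dchart c i (fun q => metric g c q j l : R)).
  exact/chart_smooth_dchart/chart_smooth_coord/chart_smooth_metric.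
apply: chart_smooth_sum => i; apply: chart_smooth_sum => j.
apply: chart_smoothZ; first exact: chart_smooth_coord.
apply: chart_smoothD; first exact/chart_smooth_dchart/chart_smooth_dphi.
apply: chart_smoothN; apply: chart_smooth_sum => k.
apply: chart_smoothZ; last exact: chart_smooth_dphi.
apply: chart_smoothM; first exact: chart_smooth_cst.
apply: chart_smooth_sum => l; apply: chart_smoothM.
  exact: chart_smooth_coord.
apply: chart_smoothD; first by apply: chart_smoothD; exact: sdG.
have -> : (fun p => - dchart c l (fun q => metric g c q i j : R^o) p) =
  (fun p => (-1) * dchart c l (fun q => metric g c q i j : R) p).
  by apply/funext => p; rewrite mulN1r.
by apply: chart_smoothM; [exact: chart_smooth_cst|exact: sdG].
Qed.

Lemma row_frame p i : row i (frame c p) = dchart c i phi p.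
Proof. exact: rowK. Qed.

Lemma frame_metric p : cdom c p -> frame c p *m (frame c p)^T = metric g c p.
Proof.
move=> cp; apply/matrixP => i j; rewrite -phi_metric// mxE dotE.
by apply: eq_bigr => k _; rewrite !mxE.
Qed.

Lemma laplace_sub_frame p :
  (\sum_i \sum_j invmx (metric g c p) i j *: dchart c i (dchart c j phi) p
   - laplace c p <= frame c p)%MS.
Proof.
rewrite /laplace /gtrace -sumrB summx_sub// => i _.
rewrite -sumrB summx_sub// => j _.
rewrite -scalerBr opprB addrC subrK scalemx_sub// summx_sub// => k _.
by rewrite scalemx_sub// -row_frame row_sub.
Qed.

Lemma laplace_mul_frame p : cdom c p -> laplace c p *m (frame c p)^T = 0.
Proof.
move=> cp; apply/rowP => l; rewrite [RHS]mxE -(laplace_normal l cp) /dot.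
by rewrite !mxE; apply: eq_bigr => k _; rewrite !mxE.
Qed.

End InChart.

(** Inside the open chart image, the image of [A] is its preimage under the
    continuous inverse of the chart. *)
Lemma chart_image_open (c : chart R m M) (A : set M) : open A -> A `<=` cdom c ->
  open (cmap c @` A).
Proof.
move=> oA Ac; rewrite openE => _ [p Ap <-].
have cp : cdom c p := Ac p Ap.
have cinv_cont : {for cmap c p, continuous (cinv c)}.
  have := @cinv_continuous _ _ _ c; rewrite continuous_open_subspace; last exact: cimg_open.
  by apply; rewrite inE; exact: cmap_cimg.
near=> y; exists (cinv c y).
  near: y; apply: (cinv_cont A); apply: open_nbhs_nbhs; split => //.
  by rewrite cmapK.
rewrite cinvK//; near: y; apply: open_nbhs_nbhs; split; first exact: cimg_open.
exact: cmap_cimg.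
Unshelve. all: by end_near. Qed.

(** Both sides represent, modulo tangent vectors, the trace of the second
    derivatives of [phi], and both are normal. *)
Lemma laplace_chart (c c' : chart R m M) p : atlas c -> atlas c' ->
  cdom c p -> cdom c' p -> laplace c' p = laplace c p.
Proof.
move=> cA c'A cp c'p.
pose U' := cmap c' @` (cdom c' `&` cdom c).
pose T := cmap c \o cinv c'; pose f := phi \o cinv c; pose f' := phi \o cinv c'.
have oU' : open U'.
  apply: chart_image_open; last exact: subIsetl.
  by apply: openI; exact: cdom_open.
have U'y : U' (cmap c' p) by exists p.
have sT : smooth_on U' T by exact: transition_smooth.
have U'T z : U' z -> (cmap c @` cdom c) (T z).
  by case=> q [c'q cq <-]; rewrite /T /= cmapK//; exact: cmap_cimg.
have f'E : {in U', f' =1 f \o T}.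
  by move=> z; rewrite inE => -[q [c'q cq <-]]; rewrite /f' /f /T /= !cmapK.
have Ty : T (cmap c' p) = cmap c p by rewrite /T /= cmapK.
have sf : smooth_on (cmap c @` cdom c) f by exact: chart_smooth_phi.
pose J := \matrix_(i, a) ('D_(delta_mx 0 i) T (cmap c' p) 0 a).
have FJ : frame c' p = J *m frame c p.
  apply/row_matrixP => i; rewrite row_mul mulmx_sum_row row_frame.
  transitivity ('D_(delta_mx 0 i) (f \o T) (cmap c' p)).
    exact: (derive_on oU' _ f'E U'y).
  rewrite derive_chain.
  - by apply: eq_bigr => a _; rewrite row_frame Ty !mxE.
  - exact: smooth_on_diff sT U'y.
  - exact: smooth_on_diff sf (U'T _ U'y).
have G'E : metric g c' p = J *m metric g c p *m J^T.
  by rewrite -!frame_metric// FJ trmx_mul !mulmxA.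
have uJ : J \in unitmx.
  by have := metric_unitmx c'A c'p; rewrite G'E unitmx_mul => /andP[+ _];
    rewrite unitmx_mul => /andP[].
have PE : J^T *m invmx (metric g c' p) *m J = invmx (metric g c p).
  have uJT : J^T \in unitmx by rewrite unitmx_tr.
  have uG := metric_unitmx cA cp.
  rewrite -[LHS](mulmxK uG) -[X in X *m invmx _](mulmxK uJT).
  rewrite -(mulmxA _ J) -(mulmxA _ (J *m _)) -G'E.
  by rewrite -(mulmxA J^T) mulVmx ?metric_unitmx// mulmx1 mulmxV// mul1mx.
have second i j : (dchart c' i (dchart c' j phi) p
    - \sum_a \sum_b (J j a * J i b) *: dchart c b (dchart c a phi) p
    <= frame c p)%MS.
  have -> : dchart c' i (dchart c' j phi) p =
    \sum_a 'D_(delta_mx 0 i) ('D_(delta_mx 0 j) T) (cmap c' p) 0 a *: row a (frame c p)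
    + \sum_a \sum_b (J j a * J i b) *: dchart c b (dchart c a phi) p.
    apply: etrans (dchart2E _ i j c'p) _.
    transitivity ('D_(delta_mx 0 i) ('D_(delta_mx 0 j) (f \o T)) (cmap c' p)).
      apply: (derive_on oU' _ _ U'y) => z; rewrite inE => Uz.
      exact: (derive_on oU' _ f'E Uz).
    apply: etrans (derive2_chain i j (@cimg_open _ _ _ c) oU' sf sT U'T U'y) _.
    apply: (f_equal2 +%R); apply: eq_bigr => a _; first by rewrite row_frame Ty.
    apply: eq_bigr => b _; rewrite (dchart2E _ b a cp) Ty.
    apply: (f_equal2 *:%R); last by [].
    by rewrite !mxE.
  by rewrite addrK summx_sub// => a _; rewrite scalemx_sub// row_sub.
apply: (normal_representative_unique (gtrace_change_sub PE second)).
- have := laplace_sub_frame c' p; rewrite FJ => /submx_trans; apply.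
  exact: submxMl.
- exact: laplace_sub_frame.
- have := laplace_mul_frame c'A c'p; rewrite FJ trmx_mul mulmxA.
  by move=> /(congr1 (mulmx^~ (invmx J^T))); rewrite mulmxK ?unitmx_tr// mul0mx.
- exact: laplace_mul_frame.
Qed.

End ImmersedManifold.

(** * The curvature of a round sphere *)

Section TangentialProjection.
Context (R : realType) (N : nat) (nu : 'rV[R]_N -> seq 'rV[R]_N) (x : 'rV[R]_N).

Lemma tprojD v w : tproj nu x (v + w) = tproj nu x v + tproj nu x w.
Proof.
rewrite /tproj addrACA -opprD -big_split /=; congr (_ - _).
by apply: eq_bigr => u _; rewrite dotDl scalerDl.
Qed.

Lemma tprojZ a w : tproj nu x (a *: w) = a *: tproj nu x w.
Proof.
rewrite /tproj scalerBr scaler_sumr; congr (_ - _).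
by apply: eq_bigr => u _; rewrite dotZl scalerA.
Qed.

Lemma tproj0 : tproj nu x 0 = 0.
Proof. by have := tprojZ 0 0; rewrite !scale0r. Qed.

Lemma tprojN w : tproj nu x (- w) = - tproj nu x w.
Proof. by rewrite -scaleN1r tprojZ scaleN1r. Qed.

Lemma tproj_sum I (s : seq I) (P : pred I) (F : I -> 'rV[R]_N) :
  tproj nu x (\sum_(i <- s | P i) F i) = \sum_(i <- s | P i) tproj nu x (F i).
Proof. by elim/big_rec2: _ => [|i u v _ <-]; rewrite ?tproj0 ?tprojD. Qed.

End TangentialProjection.

Section SphereCurvature.
Context (R : realType) (n : nat) (r : R).
Hypothesis r_gt0 : 0 < r.
Implicit Types x u v w y : 'rV[R]_n.+1.
Local Notation nu := (sphere_normal r).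
Local Notation q := (r ^- 2).

Lemma tproj_sphere x w : tproj nu x w = w - (q * dot w x) *: x.
Proof.
rewrite /tproj /sphere_normal big_seq1 dotZr scalerA; congr (_ - _ *: _).
by rewrite -exprVn; ring.
Qed.

Lemma tproj_sphere_tangent x w : dot w x = 0 -> tproj nu x w = w.
Proof. by move=> wx; rewrite tproj_sphere wx mulr0 scale0r subr0. Qed.

Lemma tproj_sphere_normal x : dot x x = r ^+ 2 -> tproj nu x x = 0.
Proof. by move=> xx; rewrite tproj_sphere xx mulVf ?scale1r ?subrr// sqrf_eq0 gt_eqF. Qed.

Lemma dot_tproj_sphere x v w : dot v x = 0 -> dot (tproj nu x w) v = dot w v.
Proof.
by move=> vx; rewrite tproj_sphere dotBl dotZl (dotC x) vx mulr0 subr0.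
Qed.

Lemma differentiable_tproj (G : 'rV[R]_n.+1 -> 'rV[R]_n.+1) x :
  differentiable G x -> differentiable (fun y => tproj nu y (G y)) x.
Proof.
move=> dG; under eq_fun do rewrite tproj_sphere.
have did : differentiable (@id 'rV[R]_n.+1) x by [].
apply: (differentiableB dG); apply: differentiableZM => //.
apply: (@differentiableM _ _ (cst q)); first exact: differentiable_cst.
exact: differentiable_dot.
Qed.

Lemma derive_scaled_dot w y h :
  'D_h (fun z => q * dot w z : R) y = q * dot w h.
Proof.
have did : differentiable (@id 'rV[R]_n.+1) y by [].
have dw : differentiable (cst w : 'rV[R]_n.+1 -> _) y by exact: differentiable_cst.
rewrite (@deriveMl _ _ (fun z => dot w z)); last first.
  exact/diff_derivable/(differentiable_dot dw did).
by rewrite (derive_dot _ dw did) derive_cst dot0l add0r derive_id.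
Qed.

Lemma derive_tproj_sphere w y h :
  'D_h (tproj nu ^~ w) y = - ((q * dot w h) *: y + (q * dot w y) *: h).
Proof.
have did : differentiable (@id 'rV[R]_n.+1) y by [].
have dw : differentiable (cst w : 'rV[R]_n.+1 -> _) y by exact: differentiable_cst.
have da : differentiable (fun z => q * dot w z : R) y.
  apply: (@differentiableM _ _ (cst q)); first exact: differentiable_cst.
  exact: (differentiable_dot dw did).
under eq_fun do rewrite tproj_sphere.
rewrite (deriveB (f := cst w) (g := fun z => (q * dot w z) *: z));
  [|exact/diff_derivable|exact/diff_derivable/(differentiableZM da did)].
by rewrite derive_cst sub0r (deriveZM _ da did) derive_scaled_dot derive_id.
Qed.

(** Off the sphere the radial part does not vanish, but its coefficient is a
    product in which [1 - q * dot y y] vanishes on the sphere, together with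
    its derivatives in tangent directions. Hence it does not contribute to a
    second covariant derivative. *)
Lemma nabla_sphereE v w y :
  nabla nu (tproj nu ^~ v) (tproj nu ^~ w) y =
  (- (q * dot w (tproj nu y v)) * (1 - q * dot y y)) *: y
  - (q * dot w y) *: tproj nu y (tproj nu y v).
Proof.
rewrite /nabla derive_tproj_sphere tprojN tprojD !tprojZ opprD; congr (_ - _).
have -> : tproj nu y y = (1 - q * dot y y) *: y.
  by rewrite tproj_sphere scalerBl scale1r.
by rewrite scalerA mulNr scaleNr.
Qed.

Lemma nabla2_sphere x u v w : dot x x = r ^+ 2 ->
  dot u x = 0 -> dot v x = 0 -> dot w x = 0 ->
  nabla nu (tproj nu ^~ u) (nabla nu (tproj nu ^~ v) (tproj nu ^~ w)) x =
  - (q * dot w u) *: v.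
Proof.
move=> xx ux vx wx.
have q0 : 1 - q * dot x x = 0 by rewrite xx mulVf ?subrr// sqrf_eq0 gt_eqF.
have did : differentiable (@id 'rV[R]_n.+1) x by [].
have dcst (c : 'rV[R]_n.+1) : differentiable (cst c : 'rV[R]_n.+1 -> _) x.
  exact: differentiable_cst.
have dcstR (c : R) : differentiable (cst c : 'rV[R]_n.+1 -> _) x.
  exact: differentiable_cst.
have dY := differentiable_tproj (dcst v).
have dYY := differentiable_tproj dY.
pose a (y : 'rV[R]_n.+1) : R := - (q * dot w (tproj nu y v)).
pose b (y : 'rV[R]_n.+1) : R := 1 - q * dot y y.
pose e (y : 'rV[R]_n.+1) : R := q * dot w y.
have da : differentiable a x.
  apply: (@differentiableN _ _ _ (fun y => q * dot w (tproj nu y v))).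
  exact: (differentiableM (dcstR q) (differentiable_dot (dcst w) dY)).
have db : differentiable b x.
  apply: (differentiableB (dcstR 1)).
  exact: (differentiableM (dcstR q) (differentiable_dot did did)).
have de : differentiable e x.
  exact: (differentiableM (dcstR q) (differentiable_dot (dcst w) did)).
have dab := differentiableM da db.
rewrite {1}/nabla (tproj_sphere_tangent ux).
have -> : nabla nu (tproj nu ^~ v) (tproj nu ^~ w) =
  (fun y => (a * b) y *: y) \- (fun y => e y *: tproj nu y (tproj nu y v)).
  by apply/funext => y; rewrite nabla_sphereE.
rewrite deriveB; [|exact/diff_derivable/(differentiableZM dab did)
  |exact/diff_derivable/(differentiableZM de dYY)].
rewrite (deriveZM _ dab did) (deriveZM _ de dYY) derive_id.
rewrite deriveM; [|exact/diff_derivable|exact/diff_derivable].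
have -> : 'D_u b x = 0.
  rewrite (@deriveB R _ R (cst 1) (fun y => q * dot y y));
    [|exact/diff_derivable|].
    rewrite derive_cst (@deriveMl _ _ (fun y => dot y y)); last first.
      exact/diff_derivable/differentiable_dot.
    by rewrite (derive_dot _ did did) derive_id ux dotC ux addr0 mulr0 subr0.
  exact/diff_derivable/(differentiableM (dcstR q) (differentiable_dot did did)).
rewrite /e derive_scaled_dot wx !(tproj_sphere_tangent vx).
have -> : b x = 0 by [].
have -> : (a * b) x = 0 by rewrite fctE /b q0 mulr0.
rewrite scaler0 mulr0 !scale0r !addr0 scale0r sub0r.
by rewrite tprojN tprojZ (tproj_sphere_tangent vx) scaleNr.
Qed.

(** The bracket term drops out: the derivative at [x] of the extension of a
    tangent vector is radial. *)
Lemma curvature_sphere x u v w : dot x x = r ^+ 2 ->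
  dot u x = 0 -> dot v x = 0 -> dot w x = 0 ->
  curvature nu x u v w = q *: (dot v w *: u - dot u w *: v).
Proof.
move=> xx ux vx wx; rewrite /curvature !nabla2_sphere//.
rewrite {1}/nabla derive_tproj_sphere wx mulr0 scale0r addr0 tprojN tprojZ.
rewrite tproj_sphere_normal// scaler0 oppr0 subr0 scalerBr !scalerA.
by rewrite !scaleNr opprK addrC !(dotC w).
Qed.

End SphereCurvature.

(** * Functions with vanishing differential *)

Section Connectedness.
Context (R : realType) (m N : nat) (M : manifold R m) (F : M -> 'rV[R]_N).
Hypothesis F_smooth : smooth F.

(** The vanishing of a differential at a point can be tested in any chart. *)
Lemma dchart_change (c c' : chart R m M) p i : atlas c -> atlas c' ->
  cdom c p -> cdom c' p ->
  dchart c' i F p =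
  \sum_a 'D_(delta_mx 0 i) (cmap c \o cinv c') (cmap c' p) 0 a *: dchart c a F p.
Proof.
move=> cA c'A cp c'p; pose U' := cmap c' @` (cdom c' `&` cdom c).
have oU' : open U'.
  apply: chart_image_open; last exact: subIsetl.
  by apply: openI; exact: cdom_open.
have U'y : U' (cmap c' p) by exists p.
have TE : (cmap c \o cinv c') (cmap c' p) = cmap c p by rewrite /= cmapK.
transitivity ('D_(delta_mx 0 i) ((F \o cinv c) \o (cmap c \o cinv c')) (cmap c' p)).
  apply: (derive_on oU' _ _ U'y) => z; rewrite inE => -[q [c'q cq <-]].
  by rewrite /= !cmapK.
have dT := smooth_on_diff (transition_smooth c'A cA) U'y.
have dF := smooth_on_diff (F_smooth cA) (cmap_cimg cp).
rewrite -TE in dF; apply: etrans (derive_chain _ dT dF) _.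
by apply: eq_bigr => a _; rewrite TE.
Qed.

Lemma locally_constant (c : chart R m M) p : atlas c -> cdom c p ->
  (forall q i, cdom c q -> dchart c i F q = 0) -> \forall q \near p, F q = F p.
Proof.
move=> cA cp F0.
have : nbhs (cmap c p) (cmap c @` cdom c).
  by apply: open_nbhs_nbhs; split; [exact: cimg_open|exact: cmap_cimg].
move=> /nbhs_ballP[e /= e0 eU].
have cmap_cont : {for p, continuous (cmap c)}.
  have := @cmap_continuous _ _ _ c.
  rewrite continuous_open_subspace; last exact: cdom_open.
  by apply; rewrite inE.
have Fball y : ball (cmap c p) e y -> F (cinv c y) = F p.
  move=> ey; apply/rowP => k.
  have := @zero_partials_cst R m (fun x => F (cinv c x) 0 k) (cmap c p) e _ _ y ey.
  rewrite cmapK//; apply.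
    move=> z /eU Uz; apply: (differentiable_mxP _ _).1.
    exact: smooth_on_diff (F_smooth cA) Uz.
  move=> z i /eU Uz; rewrite (derive_coord (F := F \o cinv c)).
    have := F0 (cinv c z) i (cinv_dom Uz); rewrite /dchart cinvK// => ->.
    by rewrite mxE.
  exact: smooth_on_diff (F_smooth cA) Uz.
near=> q; rewrite -(@cmapK _ _ _ c q); last first.
  by near: q; apply: open_nbhs_nbhs; split => //; exact: cdom_open.
apply: Fball; near: q; apply: (cmap_cont (ball (cmap c p) e)).
exact: nbhsx_ballx.
Unshelve. all: by end_near. Qed.

(** The level sets are open, hence also closed, and [M] is connected. *)
Lemma zero_differential_constant :
  (forall q i, dchart (chart_at q) i F q = 0) -> forall p q, F q = F p.
Proof.
move=> F0 p q.
have Fnear z : \forall y \near z, F y = F z.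
  apply: (locally_constant (chart_at_atlas z) (chart_at_dom z)) => y i cy.
  rewrite (dchart_change i (chart_at_atlas y) (chart_at_atlas z) (chart_at_dom y) cy).
  by rewrite big1// => a _; rewrite F0 scaler0.
pose B := [set y | F y = F p].
suff : B = setT by move=> BT; have : B q by rewrite BT.
have Bo : open B.
  by rewrite openE => y By; near=> z; rewrite /B /= (near (Fnear y) z).
have Bc : closed B.
  rewrite -openC openE => y By; near=> z => /= Bz; apply: By.
  by rewrite /B /= -Bz (near (Fnear y) z).
apply: (@carrier_connected _ _ M B); first by exists p.
  by exists B => //; rewrite setTI.
by exists B => //; rewrite setTI.
Unshelve. all: by end_near. Qed.

End Connectedness.

(** * Mean curvature and linear constraints *)

Section MeanCurvature.
Context (R : realType) (m N : nat) (M : manifold R m).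
Context (g : riemannian_metric M) (phi : M -> 'rV[R]_N).

(** The mean curvature in a submanifold is the projection of the one in the
    Euclidean space, because the Christoffel part is already tangent. *)
Lemma mean_curvature_laplace (nu : 'rV[R]_N -> seq 'rV[R]_N) p :
  (forall k, tproj nu (phi p) (dchart (chart_at p) k phi p)
    = dchart (chart_at p) k phi p) ->
  mean_curvature g nu phi p =
  m%:R^-1 *: tproj nu (phi p) (laplace g phi (chart_at p) p).
Proof.
move=> E; rewrite /mean_curvature /laplace /gtrace; congr (_ *: _).
rewrite tproj_sum; apply: eq_bigr => i _; rewrite tproj_sum.
apply: eq_bigr => j _; rewrite tprojZ tprojD tprojN tproj_sum.
congr (_ *: (_ - _)); apply: eq_bigr => k _; by rewrite tprojZ E.
Qed.

Hypothesis phi_smooth : smooth phi.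
Hypothesis phi_metric : forall c p, atlas c -> cdom c p ->
  forall i j, dot (dchart c i phi p) (dchart c j phi p) = metric g c p i j.
Context (c : chart R m M) (cA : atlas c).

Lemma dchart_dot_cst (F G : M -> 'rV[R]_N) (k : R) i p :
  chart_smooth c F -> chart_smooth c G ->
  (forall q, cdom c q -> dot (F q) (G q) = k) -> cdom c p ->
  dot (dchart c i F p) (G p) = - dot (F p) (dchart c i G p).
Proof.
move=> sF sG FG cp; apply/eqP; rewrite -addr_eq0 -dchart_dot//; apply/eqP.
rewrite (dchart_eq (G := fun=> k))//; first exact: dchart_cst.
by move=> q; rewrite inE => /FG.
Qed.

Lemma dchart_dot_self (F : M -> 'rV[R]_N) (k : R) i p : chart_smooth c F ->
  (forall q, cdom c q -> dot (F q) (F q) = k) -> cdom c p ->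
  dot (dchart c i F p) (F p) = 0.
Proof.
move=> sF FF cp; have /eqP := dchart_dot_cst i sF sF FF cp.
rewrite [X in _ == - X]dotC -addr_eq0 -mulr2n -mulr_natl mulf_eq0 pnatr_eq0 /=.
by move/eqP.
Qed.

Lemma dot_laplace v p : (forall k, dot (dchart c k phi p) v = 0) ->
  dot (laplace g phi c p) v =
  \sum_i \sum_j invmx (metric g c p) i j * dot (dchart c i (dchart c j phi) p) v.
Proof.
move=> Ev; rewrite dot_suml; apply: eq_bigr => i _; rewrite dot_suml.
apply: eq_bigr => j _; rewrite dotZl dotBl dot_suml big1 ?subr0// => k _.
by rewrite dotZl Ev mulr0.
Qed.

(** Differentiating the equation of a hyperplane twice. *)
Lemma dot_laplace_hyperplane (eta : 'rV[R]_N) (d : R) :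
  (forall q, cdom c q -> dot (phi q) eta = d) ->
  forall p, cdom c p -> (forall k, dot (dchart c k phi p) eta = 0) /\
  dot (laplace g phi c p) eta = 0.
Proof.
move=> phi_eta p cp.
have s_eta : chart_smooth c (fun=> eta) by exact: chart_smooth_cst.
have sphi := chart_smooth_phi phi_smooth cA.
have E0 k q : cdom c q -> dot (dchart c k phi q) eta = 0.
  move=> cq; rewrite (dchart_dot_cst (G := fun=> eta) k sphi s_eta phi_eta)//.
  by rewrite dchart_cst dot0r oppr0.
split=> [k|]; first exact: E0.
rewrite dot_laplace => [|k]; last exact: E0.
rewrite big1// => i _; rewrite big1// => j _.
have sE := chart_smooth_dphi phi_smooth cA j.
rewrite (dchart_dot_cst (G := fun=> eta) i sE s_eta (E0 j))//.
by rewrite dchart_cst dot0r oppr0 mulr0.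
Qed.

Context (r : R) (r_gt0 : 0 < r).
Hypothesis phi_sphere : forall p, dot (phi p) (phi p) = r ^+ 2.

Lemma dphi_position p k : cdom c p -> dot (dchart c k phi p) (phi p) = 0.
Proof.
move=> cp; have sphi := chart_smooth_phi phi_smooth cA.
exact: (dchart_dot_self k sphi (fun q _ => phi_sphere q) cp).
Qed.

(** Differentiating [dot phi phi = r ^+ 2] twice gives minus the metric, whose
    trace is [m]. *)
Lemma laplace_position p : cdom c p -> dot (laplace g phi c p) (phi p) = - m%:R.
Proof.
move=> cp; have sphi := chart_smooth_phi phi_smooth cA.
rewrite dot_laplace => [|k]; last exact: dphi_position.
rewrite -(gram_trace_metric (Defs.metric_sym g cA cp) (metric_posdef g cA cp)).
rewrite -sumrN; apply: eq_bigr => i _; rewrite -sumrN; apply: eq_bigr => j _.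
have sE := chart_smooth_dphi phi_smooth cA j.
rewrite (dchart_dot_cst i sE sphi (fun q cq => dphi_position j cq) cp).
by rewrite dotC phi_metric// mulrN.
Qed.

End MeanCurvature.

(** * CMC biharmonic immersions in a sphere *)

Section SphereImmersion.
Context (R : realType) (m n : nat) (M : manifold R m) (g : riemannian_metric M).
Context (r : R) (r_gt0 : 0 < r) (phi : M -> 'rV[R]_n.+1).
Hypothesis phi_immersion : isometric_immersion g phi (sphere r).
Hypothesis m_gt0 : (0 < m)%N.
Local Notation nu := (sphere_normal r).
Local Notation H := (mean_curvature g nu phi).

Let phi_smooth : smooth phi. Proof. by case: phi_immersion. Qed.

Let phi_metric c p : atlas c -> cdom c p -> forall i j,
  dot (dchart c i phi p) (dchart c j phi p) = metric g c p i j.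
Proof. by case: phi_immersion => _ _; exact. Qed.

Lemma sphere_dot p : dot (phi p) (phi p) = r ^+ 2.
Proof. by case: phi_immersion => /(_ p) /= <- _ _; rewrite sqr_enorm. Qed.

Let mR0 : m%:R != 0 :> R. Proof. by rewrite pnatr_eq0 -lt0n. Qed.

Section InChart.
Context (c : chart R m M) (cA : atlas c).

Lemma mean_curvature_sphere p : cdom c p ->
  H p = m%:R^-1 *: laplace g phi c p + r ^- 2 *: phi p.
Proof.
move=> cp; have [aA ap] := (chart_at_atlas p, chart_at_dom p).
rewrite mean_curvature_laplace => [|k]; last first.
  exact/tproj_sphere_tangent/(dphi_position phi_smooth aA sphere_dot k ap).
rewrite tproj_sphere (laplace_position phi_smooth phi_metric aA sphere_dot ap).
rewrite (laplace_chart phi_smooth phi_metric aA cA ap cp) scalerBr scalerA.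
by rewrite mulrN mulrN scaleNr opprK mulrCA mulVf ?mulr1.
Qed.

Lemma laplace_sphere p : cdom c p ->
  laplace g phi c p = m%:R *: H p - (m%:R / r ^+ 2) *: phi p.
Proof.
move=> cp; rewrite (mean_curvature_sphere cp) scalerDr !scalerA divff// scale1r.
by rewrite addrK.
Qed.

Lemma chart_smooth_mean_curvature : chart_smooth c H.
Proof.
apply: (chart_smooth_eq (F := fun p => m%:R^-1 *: laplace g phi c p + r ^- 2 *: phi p)).
  by move=> p; rewrite inE => cp; rewrite (mean_curvature_sphere cp).
apply: chart_smoothD.
  apply: chart_smoothZ; first exact: chart_smooth_cst.
  exact: (chart_smooth_laplace g phi_smooth cA).
apply: chart_smoothZ; first exact: chart_smooth_cst.
exact: (chart_smooth_phi phi_smooth cA).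
Qed.

Lemma mean_curvature_position p : cdom c p -> dot (H p) (phi p) = 0.
Proof.
move=> cp; rewrite (mean_curvature_sphere cp) dotDl !dotZl sphere_dot.
rewrite (laplace_position phi_smooth phi_metric cA sphere_dot cp).
by rewrite mulrN !mulVf ?addNr// sqrf_eq0 gt_eqF.
Qed.

Lemma mean_curvature_normal k p : cdom c p -> dot (H p) (dchart c k phi p) = 0.
Proof.
move=> cp; rewrite (mean_curvature_sphere cp) dotDl !dotZl.
rewrite (laplace_normal phi_smooth phi_metric cA k cp) dotC.
by rewrite (dphi_position phi_smooth cA sphere_dot k cp) !mulr0 addr0.
Qed.

(** With [mean_curvature_normal], this shows that the ambient derivative of [H]
    is already tangent to the sphere. *)
Lemma dH_position i p : cdom c p -> dot (dchart c i H p) (phi p) = 0.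
Proof.
move=> cp; have sphi := chart_smooth_phi phi_smooth cA.
rewrite (dchart_dot_cst i chart_smooth_mean_curvature sphi
  (fun q cq => mean_curvature_position cq) cp).
by rewrite mean_curvature_normal// oppr0.
Qed.

Lemma pullback_nabla_tension i p : cdom c p ->
  pullback_nabla nu phi c i (tension g nu phi) p = m%:R *: dchart c i H p.
Proof.
move=> cp; rewrite /pullback_nabla.
rewrite (dchartZ m%:R i chart_smooth_mean_curvature cp) tprojZ.
by rewrite tproj_sphere_tangent// dH_position.
Qed.

(** Since [H] is normal, the derivative can be moved from [H] to [dchart c j phi];
    what appears is the trace of the second fundamental form. *)
Lemma dH_dphi_trace p : cdom c p ->
  \sum_i \sum_j invmx (metric g c p) i j *
    dot (dchart c i H p) (dchart c j phi p) = - (m%:R * dot (H p) (H p)).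
Proof.
move=> cp; have -> : m%:R * dot (H p) (H p) = dot (laplace g phi c p) (H p).
  rewrite (laplace_sphere cp) dotBl !dotZl (dotC (phi p)).
  by rewrite mean_curvature_position// mulr0 subr0.
rewrite dot_laplace => [|k]; last by rewrite dotC mean_curvature_normal.
rewrite -sumrN; apply: eq_bigr => i _; rewrite -sumrN; apply: eq_bigr => j _.
rewrite -mulrN; congr (_ * _).
have sE := chart_smooth_dphi phi_smooth cA j.
rewrite (dchart_dot_cst i chart_smooth_mean_curvature sE
  (fun q cq => mean_curvature_normal j cq) cp).
by rewrite dotC.
Qed.

Context (k : R).
Hypothesis H_cmc : forall p, dot (H p) (H p) = k.

(** [|H|] is constant, so [H] is orthogonal to its derivatives, and so the second
    derivative moves onto the other factor. *)
Lemma nabla2_tension_dot i j p : cdom c p ->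
  dot (pullback_nabla nu phi c i
    (pullback_nabla nu phi c j (tension g nu phi)) p) (H p) =
  - (m%:R * dot (dchart c i H p) (dchart c j H p)).
Proof.
move=> cp; have sH := chart_smooth_mean_curvature.
have sdH l := chart_smooth_dchart l sH.
rewrite {1}/pullback_nabla dot_tproj_sphere; last exact: mean_curvature_position.
have -> : dchart c i (pullback_nabla nu phi c j (tension g nu phi)) p =
    m%:R *: dchart c i (dchart c j H) p.
  apply: (etrans _ (dchartZ m%:R i (sdH j) cp)).
  by apply: (dchart_eq i _ cp) => q; rewrite inE; exact: pullback_nabla_tension.
rewrite dotZl -mulrN; congr (_ * _).
have dHH q : cdom c q -> dot (dchart c j H q) (H q) = 0.
  by move=> cq; exact: (dchart_dot_self j sH (fun q _ => H_cmc q) cq).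
apply: etrans (dchart_dot_cst i (sdH j) sH dHH cp) _.
exact: (f_equal -%R (dotC _ _)).
Qed.

End InChart.

Context (lambda k : R).
Hypothesis H_cmc : forall p, dot (H p) (H p) = k.
Hypothesis phi_biharmonic : lambda_biharmonic g nu phi lambda.

Lemma rough_laplacian_dot p : let c := chart_at p in
  dot (rough_laplacian g nu phi (tension g nu phi) p) (H p) =
  m%:R * \sum_i \sum_j invmx (metric g c p) i j *
    dot (dchart c i H p) (dchart c j H p).
Proof.
move=> c; have [cA cp] := (chart_at_atlas p, chart_at_dom p).
have sH := chart_smooth_mean_curvature cA.
rewrite /rough_laplacian dotNl dot_suml -sumrN mulr_sumr.
apply: eq_bigr => i _; rewrite dot_suml -sumrN mulr_sumr.
apply: eq_bigr => j _; rewrite dotZl dotBl (nabla2_tension_dot cA H_cmc)//.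
rewrite dot_suml big1 ?subr0 => [|l _]; first by rewrite mulrN opprK mulrCA.
rewrite dotZl (pullback_nabla_tension cA)// dotZl.
by rewrite (dchart_dot_self l sH (fun q _ => H_cmc q) cp) !mulr0.
Qed.

Lemma curvature_trace_dot p : let c := chart_at p in
  dot (gtrace g c p (fun i j => curvature nu (phi p) (dchart c i phi p)
    (tension g nu phi p) (dchart c j phi p))) (H p) = - (m%:R ^+ 2 * r ^- 2 * k).
Proof.
move=> c; have [cA cp] := (chart_at_atlas p, chart_at_dom p).
have Ephi i := dphi_position phi_smooth cA sphere_dot i cp.
have HE i := mean_curvature_normal cA i cp.
have trG := gram_trace_metric (Defs.metric_sym g cA cp) (metric_posdef g cA cp).
transitivity (- (m%:R * r ^- 2 * k) *
    \sum_i \sum_j invmx (metric g c p) i j * metric g c p i j); last first.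
  by rewrite trG expr2; ring.
rewrite dot_suml mulr_sumr; apply: eq_bigr => i _.
rewrite dot_suml mulr_sumr; apply: eq_bigr => j _.
rewrite (curvature_sphere r_gt0 (sphere_dot p))//; last first.
  by rewrite dotZl (mean_curvature_position cA cp) mulr0.
move: (H_cmc p) HE; rewrite /tension; move: (H p) => h hk hE.
rewrite !dotZl dotBl !dotZl hE phi_metric// hk.
by ring.
Qed.

(** The biharmonic equation tested against [H]. The left-hand side is the
    defect in the Cauchy-Schwarz inequality of [gram_trace_expand]: it is
    nonnegative, and it vanishes only if [H + k *: phi] has zero differential. *)
Lemma cmc_biharmonic_identity p : let c := chart_at p in
  \sum_i \sum_j invmx (metric g c p) i j *
    dot (dchart c i H p + k *: dchart c i phi p)
      (dchart c j H p + k *: dchart c j phi p) =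
  k * (m%:R / r ^+ 2 - lambda - m%:R * k).
Proof.
move=> c; have [cA cp] := (chart_at_atlas p, chart_at_dom p).
have tH : dot (tension g nu phi p) (H p) = m%:R * k by rewrite dotZl H_cmc.
have := congr1 (fun v => dot v (H p)) (phi_biharmonic p).
rewrite /bitension dotBl dotNl rough_laplacian_dot curvature_trace_dot.
rewrite dotZl tH; set S := \sum_i _ => SE.
have := gram_trace_expand (Defs.metric_sym g cA cp) (metric_posdef g cA cp)
  m_gt0 (phi_metric cA cp) (dH_dphi_trace cA cp).
rewrite H_cmc mulrAC divff// mul1r => ->.
have -> : \sum_i \sum_j invmx (metric g c p) i j *
    dot (dchart c i H p) (dchart c j H p) = k * (m%:R / r ^+ 2 - lambda).
  apply: (mulfI mR0); move: SE; rewrite -/S => SE.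
  have -> : m%:R * S = m%:R ^+ 2 / r ^+ 2 * k - lambda * (m%:R * k).
    by rewrite -SE; ring.
  by ring.
by field; rewrite mR0 gt_eqF.
Qed.

End SphereImmersion.

(** * Small hyperspheres and the equality case *)

Section SmallHypersphere.
Context (R : realType) (n : nat) (eta : 'rV[R]_n.+1) (d a : R).
Implicit Types x w : 'rV[R]_n.+1.
Local Notation nu := (small_hypersphere_normal eta d a).

Lemma tproj_small_hypersphere x w :
  tproj nu x w = w - dot w eta *: eta
    - dot w (a^-1 *: (x - d *: eta)) *: (a^-1 *: (x - d *: eta)).
Proof.
by rewrite /tproj /small_hypersphere_normal big_cons big_seq1 opprD addrA.
Qed.

Lemma tproj_small_hypersphere_tangent x w : dot w x = 0 -> dot w eta = 0 ->
  tproj nu x w = w.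
Proof.
move=> wx we; rewrite tproj_small_hypersphere we dotZr dotBr dotZr wx we.
by rewrite mulr0 subr0 mulr0 !scale0r !subr0.
Qed.

Hypothesis eta_unit : dot eta eta = 1.
Hypothesis a_gt0 : 0 < a.

(** A point [x] of the small hypersphere is [a] times its radial unit vector plus
    [d *: eta], so the normal space is spanned by [eta] and [x]. *)
Lemma tproj_small_hypersphere_normal x : dot x eta = d ->
  dot x x = d ^+ 2 + a ^+ 2 -> tproj nu x eta = 0 /\ tproj nu x x = 0.
Proof.
move=> xe xx; have a0 : a != 0 by rewrite gt_eqF.
have eu : dot eta (a^-1 *: (x - d *: eta)) = 0.
  by rewrite dotZr dotBr dotZr eta_unit dotC xe mulr1 subrr mulr0.
have xu : dot x (a^-1 *: (x - d *: eta)) = a.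
  by rewrite dotZr dotBr dotZr xe xx; field.
rewrite !tproj_small_hypersphere eu xu eta_unit xe scale1r subrr scale0r subr0.
by rewrite scalerA divff// scale1r subrr.
Qed.

End SmallHypersphere.

Section Rigidity.
Context (R : realType) (m n : nat) (M : manifold R m) (g : riemannian_metric M).
Context (r : R) (r_gt0 : 0 < r) (phi : M -> 'rV[R]_n.+1).
Hypothesis phi_immersion : isometric_immersion g phi (sphere r).
Hypothesis m_gt0 : (0 < m)%N.
Local Notation nu := (sphere_normal r).
Local Notation H := (mean_curvature g nu phi).

Let mR_gt0 : 0 < m%:R :> R. Proof. by rewrite ltr0n. Qed.

Let phi_smooth : smooth phi. Proof. by case: phi_immersion. Qed.

Let phi_metric c p : atlas c -> cdom c p -> forall i j,
  dot (dchart c i phi p) (dchart c j phi p) = metric g c p i j.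
Proof. by case: phi_immersion => _ _; exact. Qed.

Section Bound.
Context (lambda k : R) (p : M).
Hypothesis H_cmc : forall p, dot (H p) (H p) = k.
Hypothesis phi_biharmonic : lambda_biharmonic g nu phi lambda.

Lemma cmc_biharmonic_bound : 0 < k -> m%:R * k <= m%:R / r ^+ 2 - lambda.
Proof.
move=> k0; rewrite -subr_ge0 -(pmulr_rge0 _ k0).
rewrite -(cmc_biharmonic_identity r_gt0 phi_immersion m_gt0 H_cmc phi_biharmonic p).
apply: gram_trace_ge0; [apply: Defs.metric_sym|apply: metric_posdef];
  by [exact: chart_at_atlas|exact: chart_at_dom].
Qed.

(** In the equality case the trace of squares is zero; by positive definiteness
    every partial derivative of [H + k *: phi] vanishes. *)
Lemma cmc_biharmonic_rigid q : m%:R * k = m%:R / r ^+ 2 - lambda ->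
  H q + k *: phi q = H p + k *: phi p.
Proof.
move=> mk.
have s_sum c : atlas c -> chart_smooth c (fun y => H y + k *: phi y).
  move=> cA; apply: chart_smoothD.
    exact: (chart_smooth_mean_curvature phi_immersion m_gt0 cA).
  apply: chart_smoothZ; first exact: chart_smooth_cst.
  exact: (chart_smooth_phi phi_smooth cA).
apply: (zero_differential_constant (F := fun y => H y + k *: phi y)) => // y i.
have [cA cy] := (chart_at_atlas y, chart_at_dom y).
have sphi := chart_smooth_phi phi_smooth cA.
have sH := chart_smooth_mean_curvature phi_immersion m_gt0 cA.
have skphi : chart_smooth (chart_at y) (fun y => k *: phi y).
  by apply: chart_smoothZ => //; exact: chart_smooth_cst.
apply: etrans (dchartD i sH skphi cy) _.
rewrite (dchartZ k i sphi cy).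
have := cmc_biharmonic_identity r_gt0 phi_immersion m_gt0 H_cmc phi_biharmonic y.
rewrite mk subrr mulr0.
by move/(gram_trace_eq0 (Defs.metric_sym g cA cy) (metric_posdef g cA cy)).
Qed.

End Bound.

(** The constant vector [xi] gives the axis of the hyperplane. As [H] is normal
    to [phi] and of squared length [k], the product of [xi] with [phi] is
    [k * r ^+ 2] and its squared length [k * (1 + k * r ^+ 2)], which determines
    the distance [d] of the hyperplane to the origin and the radius [a]. *)
Lemma minimal_of_constant (k a : R) (p : M) :
  (forall q, dot (H q) (H q) = k) -> 0 < k -> 0 < a ->
  a ^+ 2 = r ^+ 2 / (1 + k * r ^+ 2) ->
  (forall q, H q + k *: phi q = H p + k *: phi p) ->
  minimal_in_small_hypersphere g phi r a.
Proof.
move=> H_cmc k0 a0 a2 Hk; pose xi := H p + k *: phi p.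
have xiE q : H q + k *: phi q = xi := Hk q.
have H_phi q : dot (H q) (phi q) = 0.
  exact: (mean_curvature_position r_gt0 phi_immersion m_gt0 (chart_at_atlas q)
    (chart_at_dom q)).
have phi2 := sphere_dot phi_immersion.
have phi_xi q : dot (phi q) xi = k * r ^+ 2.
  by rewrite -(xiE q) dotDr (dotZr k) (dotC (phi q)) H_phi phi2 add0r.
have xi2 : dot xi xi = k * (1 + k * r ^+ 2).
  rewrite -{1}(xiE p) dotDl (dotZl k) phi_xi -(xiE p) dotDr (dotZr k) H_phi H_cmc.
  by ring.
have r20 : 0 < r ^+ 2 by rewrite exprn_gt0.
have kr : 0 < 1 + k * r ^+ 2 by rewrite ltr_wpDl// mulr_gt0.
have nxi2 : enorm xi ^+ 2 = k * (1 + k * r ^+ 2) by rewrite sqr_enorm.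
have nxi0 : 0 < enorm xi.
  by rewrite lt_def enorm_ge0 andbT -sqrf_eq0 nxi2 gt_eqF// mulr_gt0.
pose eta := (enorm xi)^-1 *: xi; pose d := (enorm xi)^-1 * (k * r ^+ 2).
have eta1 : dot eta eta = 1.
  by rewrite dotZl dotZr -sqr_enorm; field; rewrite gt_eqF.
have phi_eta q : dot (phi q) eta = d by rewrite dotZr phi_xi.
have d2 : d ^+ 2 + a ^+ 2 = r ^+ 2.
  rewrite a2 /d exprMn exprVn nxi2; field.
  by rewrite !gt_eqF.
have d0 : d != 0 by rewrite mulf_neq0 ?invr_eq0 ?mulf_neq0// gt_eqF.
have xE q : H q = enorm xi *: eta - k *: phi q.
  by rewrite scalerA divff ?gt_eqF// scale1r -(xiE q) addrK.
clearbody eta d.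
have imm : isometric_immersion g phi (small_hypersphere r eta d).
  split => // q; split; last exact: phi_eta.
  by case: phi_immersion.
exists eta, d; split => //.
- by apply/eqP; rewrite -(@eqrXn2 _ 2) ?enorm_ge0// sqr_enorm eta1 expr1n.
split => // q; have [cA cq] := (chart_at_atlas q, chart_at_dom q).
have E0 := (dot_laplace_hyperplane g phi_smooth cA (fun q _ => phi_eta q) cq).1.
have Ephi i := dphi_position phi_smooth cA phi2 i cq.
rewrite mean_curvature_laplace; last first.
  by move=> i; apply: tproj_small_hypersphere_tangent.
rewrite (laplace_sphere phi_immersion m_gt0 cA cq).
have [|eta0 phi0] := tproj_small_hypersphere_normal eta1 a0 (phi_eta q).
  by rewrite phi2 d2.
by rewrite xE tprojD tprojN !tprojZ tprojD tprojN !tprojZ eta0 phi0 !scaler0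
  subrr scaler0 subrr scaler0.
Qed.

(** Minimality makes the Laplacian of [phi] a multiple of the radial unit vector
    of the small hypersphere; the factor follows from [laplace_position]. *)
Lemma minimal_in_small_hypersphere_norm (a : R) (p : M) :
  minimal_in_small_hypersphere g phi r a ->
  dot (H p) (H p) = (a ^+ 2)^-1 - (r ^+ 2)^-1.
Proof.
move=> [eta [d [eta1 d0 a0 d2 [imm mini]]]].
have {}eta1 : dot eta eta = 1 by rewrite -sqr_enorm eta1 expr1n.
have phi_eta q : dot (phi q) eta = d by case: imm => /(_ q)[].
have [cA cp] := (chart_at_atlas p, chart_at_dom p).
have phi2 := sphere_dot phi_immersion.
have [E0 L_eta] := dot_laplace_hyperplane g phi_smooth cA (fun q _ => phi_eta q) cp.
have Ephi i := dphi_position phi_smooth cA phi2 i cp.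
have L_phi := laplace_position phi_smooth phi_metric cA phi2 cp.
have := mini p; rewrite mean_curvature_laplace; last first.
  by move=> i; apply: tproj_small_hypersphere_tangent.
have -> := mean_curvature_sphere phi_immersion m_gt0 cA cp.
move: L_eta L_phi; move: (laplace _ _ _ _) => L L_eta L_phi.
move/eqP; rewrite scaler_eq0 invr_eq0 gt_eqF//= tproj_small_hypersphere.
rewrite L_eta scale0r subr0 dotZr dotBr dotZr L_eta L_phi mulr0 subr0.
rewrite subr_eq0 => /eqP LE.
have L2 : dot L L = m%:R ^+ 2 / a ^+ 2.
  rewrite [X in dot X _]LE !dotZl dotBl dotZl (dotC (phi p)) (dotC eta) L_eta L_phi.
  by field; rewrite gt_eqF.
rewrite dotDl !dotDr !dotZl !dotZr L2 (dotC (phi p)) L_phi phi2.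
by field; rewrite !gt_eqF.
Qed.

End Rigidity.

(** * The gap theorem *)

Theorem theorem3p6 (R : realType) (m n : nat)
    (M : manifold R m) (g : riemannian_metric M)
    (lambda r : R) (r_gt0 : 0 < r)
    (phi : M -> 'rV[R]_n.+1)
    (phi_immersion : isometric_immersion g phi (sphere r))
    (phi_cmc : cmc g (sphere_normal r) phi)
    (phi_biharmonic : proper_lambda_biharmonic g (sphere_normal r) phi lambda) :
  let absH := fun p : M => enorm (mean_curvature g (sphere_normal r) phi p) in
  let bound := Num.sqrt (1 / r ^+ 2 - lambda / m%:R) in
  [/\ lambda < m%:R / r ^+ 2,
      (forall p : M, 0 < absH p <= bound)
    & (forall p : M, absH p = bound) <->
      minimal_in_small_hypersphere g phi r
        (Num.sqrt (m%:R * r ^+ 2 / (2 * m%:R - lambda * r ^+ 2)))].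
Proof.
move=> absH bound; have [biharm nonmin] := phi_biharmonic.
have [h hE] := phi_cmc.
have [p0 Hp0] : exists p, mean_curvature g (sphere_normal r) phi p != 0.
  apply: contrapT => H0; apply: nonmin => p; apply/eqP/negP => Hp.
  by apply: H0; exists p; apply/negP.
have m_gt0 : (0 < m)%N.
  rewrite lt0n; apply: contra_neqN Hp0 => /eqP m0.
  have mV0 : m%:R^-1 = 0 :> R by rewrite m0 invr0.
  by rewrite /mean_curvature mV0 scale0r.
have h0 : 0 < h by rewrite -(hE p0) lt_def enorm_ge0 enorm_eq0 Hp0.
have H_cmc p : dot (mean_curvature g (sphere_normal r) phi p)
    (mean_curvature g (sphere_normal r) phi p) = h ^+ 2.
  by rewrite -sqr_enorm hE.
have h20 : 0 < h ^+ 2 by rewrite exprn_gt0.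
have mR : 0 < m%:R :> R by rewrite ltr0n.
have r20 : 0 < r ^+ 2 by rewrite exprn_gt0.
have mh := cmc_biharmonic_bound r_gt0 phi_immersion m_gt0 p0 H_cmc biharm h20.
have lam : lambda < m%:R / r ^+ 2.
  by rewrite -subr_gt0; apply: lt_le_trans mh; rewrite mulr_gt0.
have b2E : 1 / r ^+ 2 - lambda / m%:R = (m%:R / r ^+ 2 - lambda) / m%:R.
  by field; rewrite !gt_eqF.
have h2b : h ^+ 2 <= 1 / r ^+ 2 - lambda / m%:R.
  by rewrite b2E ler_pdivlMr// mulrC.
have b0 : 0 <= 1 / r ^+ 2 - lambda / m%:R by exact: le_trans (ltW h20) h2b.
split => //.
  move=> p; rewrite /absH hE h0 /=.
  by rewrite -(ger0_norm (ltW h0)) -sqrtr_sqr ler_wsqrtr.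
have lr : lambda * r ^+ 2 < m%:R by rewrite -ltr_pdivlMr.
have den0 : 0 < 2 * m%:R - lambda * r ^+ 2.
  by rewrite mulrDl mul1r -addrA addr_gt0// subr_gt0.
set a := Num.sqrt (m%:R * r ^+ 2 / _).
have frac0 : 0 < m%:R * r ^+ 2 / (2 * m%:R - lambda * r ^+ 2).
  by rewrite divr_gt0// mulr_gt0.
have a0 : 0 < a by rewrite sqrtr_gt0.
have a2 : a ^+ 2 = m%:R * r ^+ 2 / (2 * m%:R - lambda * r ^+ 2).
  by rewrite sqr_sqrtr// ltW.
split=> [Hb|mini p].
  have h2E : h ^+ 2 = 1 / r ^+ 2 - lambda / m%:R.
    by rewrite -(hE p0) [enorm _]Hb sqr_sqrtr.
  have mhE : m%:R * h ^+ 2 = m%:R / r ^+ 2 - lambda.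
    by rewrite h2E; field; rewrite !gt_eqF.
  have xiE q := cmc_biharmonic_rigid r_gt0 phi_immersion m_gt0 p0 H_cmc biharm q mhE.
  apply: (minimal_of_constant r_gt0 phi_immersion m_gt0 H_cmc h20 a0 _ xiE).
  have -> : 1 + h ^+ 2 * r ^+ 2 = (2 * m%:R - lambda * r ^+ 2) / m%:R.
    by rewrite h2E; field; rewrite !gt_eqF.
  by rewrite a2; field; rewrite !gt_eqF.
apply/eqP; rewrite -(@eqrXn2 _ 2) ?enorm_ge0 ?sqrtr_ge0//; apply/eqP.
rewrite sqr_enorm sqr_sqrtr//.
rewrite (minimal_in_small_hypersphere_norm r_gt0 phi_immersion m_gt0 p mini) a2.
by field; rewrite !gt_eqF.
Qed.
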